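(* Assume $\mathrm{CH}$. There is an embedding $e:\mathcal P(\mathbb N)/\mathrm{fin}\to\mathcal P(\mathbb N)/\mathrm{fin}$ such that $R_e=\{\mathrm{id}\}$, i.e. the only automorphism $h$ of $\mathcal P(\mathbb N)/\mathrm{fin}$ whose restriction to $\mathrm{rng}(e)$ is an automorphism of $\mathrm{rng}(e)$ is the identity.
   Context: $\mathrm{CH}$ is the Continuum Hypothesis. $\mathcal P(\mathbb N)/\mathrm{fin}$ is the Boolean algebra of subsets of $\mathbb N$ modulo finite sets; an embedding is an injective Boolean homomorphism. For an embedding $e:\mathbb B\to\mathbb A$, $R_e=\{h\in\mathrm{Aut}(\mathbb A): h\restriction\mathrm{rng}(e)\in\mathrm{Aut}(\mathrm{rng}(e))\}$. *)

(* Defs.v *)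
From HB Require Import structures.
From mathcomp Require Import all_boot all_order.
From mathcomp Require Import boolp classical_sets functions cardinality.

Set Implicit Arguments.
Unset Strict Implicit.
Unset Printing Implicit Defensive.

Import Order.TTheory.
Local Open Scope classical_set_scope.
Local Open Scope quotient_scope.
Local Open Scope card_scope.

Definition CH : Prop :=
  forall X : set (set nat), countable X \/ X #= [set: set nat].

Definition eq_mod_fin (A B : set nat) : bool := `[< finite_set (A `+` B) >].

Lemma eq_mod_fin_refl : reflexive eq_mod_fin.
Proof. by move=> A; apply/asboolP; rewrite setYK; exact: finite_set0. Qed.

Lemma eq_mod_fin_sym : symmetric eq_mod_fin.
Proof. by move=> A B; rewrite /eq_mod_fin setYC. Qed.

Lemma eq_mod_fin_trans : transitive eq_mod_fin.
Proof.
move=> B A C /asboolP AB /asboolP BC; apply/asboolP.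
apply: (@sub_finite_set _ _ ((A `+` B) `|` (B `+` C))); last first.
  by rewrite finite_setU.
move=> n [[An Cn]|[Cn An]]; have [Bn|Bn] := pselect (B n).
- by right; left.
- by left; left.
- by left; right.
- by right; right.
Qed.

Canonical eq_mod_fin_equiv :=
  EquivRel eq_mod_fin eq_mod_fin_refl eq_mod_fin_sym eq_mod_fin_trans.

Definition Pfin := {eq_quot eq_mod_fin}.

HB.instance Definition _ := Choice.on Pfin.
HB.instance Definition _ := EqQuotient.on Pfin.

Definition Pfin_cap := lift_op2 Pfin (@setI nat).
Definition Pfin_cup := lift_op2 Pfin (@setU nat).
Definition Pfin_compl := lift_op1 Pfin (@setC nat).

Lemma eq_mod_finP (A B : set nat) :
  reflect (finite_set (A `+` B)) (\pi_Pfin A == \pi_Pfin B).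
Proof. by rewrite eqmodE; exact: asboolP. Qed.

Lemma pi_Pfin_cap : {morph \pi_Pfin : A B / A `&` B >-> Pfin_cap A B}.
Proof.
move=> A B; unlock Pfin_cap; apply/eqP/eq_mod_finP.
have /eqP/eq_mod_finP fA : \pi_Pfin A = \pi_Pfin (repr (\pi_Pfin A)).
  by rewrite reprK.
have /eqP/eq_mod_finP fB : \pi_Pfin B = \pi_Pfin (repr (\pi_Pfin B)).
  by rewrite reprK.
apply: sub_finite_set (_ : finite_set (_ `|` _)); last first.
  by rewrite finite_setU; split; [exact: fA|exact: fB].
move: (repr _) (repr _) => A' B' n; rewrite /setY /setU /setD /setI /=.
by case: (pselect (A' n)) (pselect (B' n)) (pselect (A n)) (pselect (B n))
  => ? [] ? [] ? [] ?; tauto.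
Qed.

Lemma pi_Pfin_cup : {morph \pi_Pfin : A B / A `|` B >-> Pfin_cup A B}.
Proof.
move=> A B; unlock Pfin_cup; apply/eqP/eq_mod_finP.
have /eqP/eq_mod_finP fA : \pi_Pfin A = \pi_Pfin (repr (\pi_Pfin A)).
  by rewrite reprK.
have /eqP/eq_mod_finP fB : \pi_Pfin B = \pi_Pfin (repr (\pi_Pfin B)).
  by rewrite reprK.
apply: sub_finite_set (_ : finite_set (_ `|` _)); last first.
  by rewrite finite_setU; split; [exact: fA|exact: fB].
move: (repr _) (repr _) => A' B' n; rewrite /setY /setU /setD /setI /=.
by case: (pselect (A' n)) (pselect (B' n)) (pselect (A n)) (pselect (B n))
  => ? [] ? [] ? [] ?; tauto.
Qed.

Lemma pi_Pfin_compl : {morph \pi_Pfin : A / ~` A >-> Pfin_compl A}.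
Proof.
move=> A; unlock Pfin_compl; apply/eqP/eq_mod_finP.
have /eqP/eq_mod_finP : \pi_Pfin A = \pi_Pfin (repr (\pi_Pfin A)).
  by rewrite reprK.
apply: sub_finite_set; move: (repr _) => A' n.
rewrite /setY /setU /setD /setC /=.
by case: (pselect (A n)) (pselect (A' n)) => ? [] ?; tauto.
Qed.

Fact Pfin_display : Order.disp_t. Proof. exact: Order.Disp tt tt. Qed.

Section PfinBooleanAlgebra.
Implicit Types x y z : Pfin.

Definition Pfin_le x y := Pfin_cap x y == x.
Definition Pfin_lt x y := (y != x) && Pfin_le x y.

Lemma Pfin_capC : commutative Pfin_cap.
Proof. by elim/quotW=> A; elim/quotW=> B; rewrite -!pi_Pfin_cap setIC. Qed.

Lemma Pfin_cupC : commutative Pfin_cup.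
Proof. by elim/quotW=> A; elim/quotW=> B; rewrite -!pi_Pfin_cup setUC. Qed.

Lemma Pfin_capA : associative Pfin_cap.
Proof.
elim/quotW=> A; elim/quotW=> B; elim/quotW=> C.
by rewrite -!pi_Pfin_cap setIA.
Qed.

Lemma Pfin_cupA : associative Pfin_cup.
Proof.
elim/quotW=> A; elim/quotW=> B; elim/quotW=> C.
by rewrite -!pi_Pfin_cup setUA.
Qed.

Lemma Pfin_cupKI y x : Pfin_cap x (Pfin_cup x y) = x.
Proof.
elim/quotW: x => A; elim/quotW: y => B.
by rewrite -pi_Pfin_cup -pi_Pfin_cap setUC setKU.
Qed.

Lemma Pfin_capKU y x : Pfin_cup x (Pfin_cap x y) = x.
Proof.
elim/quotW: x => A; elim/quotW: y => B.
by rewrite -pi_Pfin_cap -pi_Pfin_cup setIC setKI.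
Qed.

Lemma Pfin_capUl : left_distributive Pfin_cap Pfin_cup.
Proof.
elim/quotW=> A; elim/quotW=> B; elim/quotW=> C.
by rewrite -!(pi_Pfin_cup, pi_Pfin_cap) setIUl.
Qed.

Lemma Pfin_capxx : idempotent_op Pfin_cap.
Proof. by elim/quotW=> A; rewrite -pi_Pfin_cap setIid. Qed.

HB.instance Definition _ :=
  Order.isMeetJoinDistrLattice.Build Pfin_display Pfin
    (fun _ _ => erefl : Pfin_le _ _ = _)
    (fun _ _ => erefl : Pfin_lt _ _ = _)
    Pfin_capC Pfin_cupC Pfin_capA Pfin_cupA Pfin_cupKI Pfin_capKU
    Pfin_capUl Pfin_capxx.

Lemma Pfin_le0x x : (\pi_Pfin set0 <= x)%O.
Proof.
by elim/quotW: x => A; rewrite leEmeet /Order.meet /= -pi_Pfin_cap set0I.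
Qed.

Lemma Pfin_lex1 x : (x <= \pi_Pfin setT)%O.
Proof.
by elim/quotW: x => A; rewrite leEmeet /Order.meet /= -pi_Pfin_cap setIT.
Qed.

HB.instance Definition _ :=
  Order.hasBottom.Build Pfin_display Pfin Pfin_le0x.
HB.instance Definition _ :=
  Order.hasTop.Build Pfin_display Pfin Pfin_lex1.

Lemma Pfin_joinxC x : (x `|` Pfin_compl x = \top)%O.
Proof.
elim/quotW: x => A.
by rewrite /Order.join /= -pi_Pfin_compl -pi_Pfin_cup setUv.
Qed.

Lemma Pfin_meetxC x : (x `&` Pfin_compl x = \bot)%O.
Proof.
elim/quotW: x => A.
by rewrite /Order.meet /= -pi_Pfin_compl -pi_Pfin_cap setICr.
Qed.

HB.instance Definition _ :=
  Order.TBDistrLattice_hasComplement.Build Pfin_display Pfin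
    Pfin_joinxC Pfin_meetxC.

End PfinBooleanAlgebra.

Lemma pi_Pfin0 : \pi_Pfin set0 = \bot%O.
Proof. by []. Qed.

Lemma pi_Pfin1 : \pi_Pfin setT = \top%O.
Proof. by []. Qed.

Lemma pi_Pfin_meet : {morph \pi_Pfin : A B / A `&` B >-> (A `&` B)%O}.
Proof. exact: pi_Pfin_cap. Qed.

Lemma pi_Pfin_join : {morph \pi_Pfin : A B / A `|` B >-> (A `|` B)%O}.
Proof. exact: pi_Pfin_cup. Qed.

Lemma pi_Pfin_setC : {morph \pi_Pfin : A / ~` A >-> (~` A)%O}.
Proof. exact: pi_Pfin_compl. Qed.

Lemma Pfin_leP (A B : set nat) :
  reflect (finite_set (A `\` B)) (\pi_Pfin A <= \pi_Pfin B)%O.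
Proof.
rewrite leEmeet /Order.meet /= -pi_Pfin_cap.
suff <- : (A `&` B) `+` A = A `\` B by exact: eq_mod_finP.
apply/seteqP; split=> n; rewrite /setY /setU /setD /setI /=;
  by have [] := pselect (B n); tauto.
Qed.

Section BooleanAlgebras.
Variables (d d' : Order.disp_t).
Variables (B : ctbDistrLatticeType d) (A : ctbDistrLatticeType d').

(* f, restricted to the subalgebra D, is a Boolean homomorphism. *)
Definition boolean_hom_on (D : set B) (f : B -> A) : Prop :=
  [/\ f \bot%O = \bot%O,
      f \top%O = \top%O,
      {in D &, {morph f : x y / (x `&` y)%O}},
      {in D &, {morph f : x y / (x `|` y)%O}}
    & {in D, {morph f : x / (~` x)%O}}].

Definition embedding (e : B -> A) : Prop :=
  boolean_hom_on [set: B] e /\ injective e.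

End BooleanAlgebras.

(* The restriction of h to the subalgebra D is an automorphism of D. *)
Definition automorphism_on d (A : ctbDistrLatticeType d) (D : set A)
    (h : A -> A) : Prop :=
  set_bij D D h /\ boolean_hom_on D h.

Definition Aut d (A : ctbDistrLatticeType d) : set (A -> A) :=
  [set h | automorphism_on [set: A] h].
Arguments Aut {d} A.

Definition R_ d d' (B : ctbDistrLatticeType d) (A : ctbDistrLatticeType d')
    (e : B -> A) : set (A -> A) :=
  [set h | Aut A h /\ automorphism_on (range e) h].

(* Main.v *)
Require Import Defs.
From mathcomp Require Import all_boot all_order.
From mathcomp Require Import boolp classical_sets functions cardinality filter.
From mathcomp Require wochoice.

(** Write A for P(N)/fin and identify it with the clopen algebra of its Stone
    space. Choose points X_i (i in an index set of size aleph_1 = continuum),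
    dense in the Stone space, with no automorphism of A mapping X_i to X_j for
    i <> j: take X_i = U_i-lim d_(i,n) with d_(i,n) distinct P-points and with
    ultrafilters U_i that are pairwise Rudin-Keisler inequivalent; P-points are
    strongly discrete, so X_i determines U_i up to equivalence. Under CH each
    X_i can be doubled: the complement of {X_i} is the union of two disjoint
    open sets with X_i in both closures, and adding these open sets to A for
    all i gives a Boolean algebra C of size aleph_1 in which A is dense.

    A generic embedding of C into A, built from countable approximations,
    restricts to an embedding e of A with dense range such that every d in A
    outside the image of C has at least two boundary points, i.e. points of
    the Stone space of A all of whose neighbourhoods b satisfy
    e b /\ d <> 0 <> e b - d. Elements of the image of C have their boundary
    points among the X_i. Hence {X_i} is the set of points that form the whole
    boundary of some d, and this set is respected by each h in R_e. So h fixes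
    every X_i, hence the range of e pointwise, hence everything. *)

Set Implicit Arguments.
Unset Strict Implicit.
Unset Printing Implicit Defensive.

Import Order.Theory.
Local Open Scope classical_set_scope.
Local Open Scope quotient_scope.
Local Open Scope order_scope.

Implicit Types (a b c d p q : Pfin).

(** * Points of the Stone space *)

Definition is_point (x : set Pfin) : Prop :=
  [/\ ~ x \bot, forall a b, x (a `&` b) <-> x a /\ x b
    & forall a, x (~` a) <-> ~ x a].

Record pt := Pt { pt_mem :> Pfin -> Prop; ptP : is_point pt_mem }.

Implicit Types x y : pt.

(** Ultrafilters are maximal, so one inclusion suffices. *)
Lemma pt_ext x y : (forall a, x a -> y a) -> x = y.
Proof.
move=> xy; case: x y xy => [x Hx] [y Hy] /= xy.
have exy : x = y.
  apply/funext => a; apply/propext; split; first exact: xy.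
  move=> ya; apply: contrapT => nxa.
  case: Hx => _ _ /(_ a)[_ /(_ nxa)/xy].
  by case: Hy => _ _ /(_ a)[+ _] => /[apply]; exact.
by subst y; rewrite (Prop_irrelevance Hx Hy).
Qed.

Section PointTheory.
Variable x : pt.

Lemma pt0 : ~ x \bot. Proof. by case: (ptP x). Qed.

Lemma ptI a b : x (a `&` b) <-> x a /\ x b.
Proof. by case: (ptP x). Qed.

Lemma ptC a : x (~` a) <-> ~ x a. Proof. by case: (ptP x). Qed.

Lemma pt1 : x \top. Proof. by rewrite -compl0 ptC; exact: pt0. Qed.

Lemma ptU a b : x (a `|` b) <-> x a \/ x b.
Proof.
rewrite -[a `|` b]complK complU ptC ptI !ptC.
by case: (pselect (x a)); case: (pselect (x b)); tauto.
Qed.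

Lemma ptD a b : x (a `\` b) <-> x a /\ ~ x b.
Proof. by rewrite diffE ptI ptC. Qed.

Lemma ptW a b : a <= b -> x a -> x b.
Proof. by move=> /meet_idPl <- /ptI[]. Qed.

End PointTheory.

Lemma ultra_setC (T : Type) (F : set_system T) (A : set T) :
  UltraFilter F -> F (~` A)%classic <-> ~ F A.
Proof.
move=> FU; split=> [FC FA|nFA]; last by case: (in_ultra_setVsetC A FU).
by apply: (@filter_not_empty _ F _); rewrite -(setICl A); exact: filterI.
Qed.

Lemma ultra_setI (T : Type) (F : set_system T) (A B : set T) :
  Filter F -> F (A `&` B)%classic <-> F A /\ F B.
Proof.
move=> FF; split=> [FAB|[FA FB]]; last exact: filterI.
by split; apply: filterS FAB => t [].
Qed.

Lemma pi0P (A : set nat) : \pi_Pfin A = \bot <-> finite_set A.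
Proof.
rewrite -pi_Pfin0; split=> [/eqP/eq_mod_finP|fA]; last apply/eqP/eq_mod_finP.
  by rewrite setY0.
by rewrite setY0.
Qed.

(** An ultrafilter extending the filter of sets that almost contain [A] has no finite member, so
    membership in it depends only on the class modulo finite sets. *)
Lemma pt_ex a : a != \bot -> exists x, x a.
Proof.
elim/quotW: a => A /eqP nA.
have iA : infinite_set A by move/pi0P.
pose F : set_system nat := [set B | finite_set (A `\` B)%classic].
have FF : ProperFilter F.
  apply: Build_ProperFilter_ex.
    move=> B FB; apply: contrapT => nB; apply: iA; apply: sub_finite_set FB.
    by move=> n An; split=> // Bn; apply: nB; exists n.
  split.
  - by rewrite /F /= setDT; exact: finite_set0.
  - by move=> B C FB FC; rewrite /F /= setDIr finite_setU.
  - by move=> B C BC; apply: sub_finite_set => n [An nC]; split=> // /BC.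
have [G [GU FG]] := ultraFilterLemma FF.
have fin0 B : finite_set B -> ~ G B.
  move=> fB GB; have : G (~` B)%classic.
    by apply: FG; rewrite /F /= setDE setCK; exact: finite_setIr.
  by rewrite ultra_setC.
have Gpi B C : \pi_Pfin B = \pi_Pfin C -> G B -> G C.
  move=> /eqP/eq_mod_finP fBC GB; apply: contrapT => nGC.
  apply: (@fin0 (B `\` C)%classic); first by apply: sub_finite_set fBC => n; left.
  by rewrite setDE; apply: filterI => //; rewrite ultra_setC.
have Gr B : G (repr (\pi_Pfin B)) <-> G B by split; apply: Gpi; rewrite reprK.
suff Gpt : is_point (fun a => G (repr a)).
  exists (Pt Gpt) => /=; apply/Gr; apply: FG.
  by rewrite /F /= setDv; exact: finite_set0.
split.
- by rewrite -pi_Pfin0 Gr; exact: filter_not_empty.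
- elim/quotW=> B; elim/quotW=> C; rewrite -pi_Pfin_meet !Gr.
  exact: ultra_setI.
- by elim/quotW=> B; rewrite -pi_Pfin_setC !Gr; exact: ultra_setC.
Qed.

Lemma neq0P a : a <> \bot <-> exists x, x a.
Proof.
split=> [/eqP/pt_ex//|[x xa] a0]; by move: xa; rewrite a0 => /pt0.
Qed.

Lemma eq0P a : a = \bot <-> forall x, ~ x a.
Proof.
split=> [-> x /pt0//|H]; apply: contrapT => /neq0P[x xa]; exact: H xa.
Qed.

(** Stone duality: it lets later order relations and identities in [Pfin] be checked pointwise, as
    propositional tautologies. *)
Lemma lePt a b : a <= b <-> forall x, x a -> x b.
Proof.
split=> [ab x|H]; first exact: ptW.
by rewrite -diff_eq0; apply/eqP/eq0P => x; rewrite ptD => -[/H].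
Qed.

Lemma nlePt a b : ~ (a <= b) <-> exists x, x a /\ ~ x b.
Proof.
rewrite lePt; split; last by move=> [x [xa nxb]] /(_ x xa).
move=> H; apply: contrapT => N; apply: H => x xa; apply: contrapT => nxb.
by apply: N; exists x.
Qed.

Lemma eqPt a b : (forall x, x a <-> x b) -> a = b.
Proof.
by move=> H; apply/eqP; rewrite eq_le; apply/andP; split;
  apply/lePt => x /H.
Qed.

(** * Countable saturation of P(N)/fin *)

Lemma countable_range (T : Type) (S : set T) (t0 : T) :
  countable S -> S t0 -> exists f : nat -> T, S = range f.
Proof.
move=> cS St0; have /pfcard_geP[S0|[f]] := cS; first by move: St0; rewrite S0.
exists f; apply/esym/surj_image_eq; last exact: surj.
by move=> t [n _ <-]; exact: funS.
Qed.

Lemma meet0P a b : a `&` b = \bot <-> forall x, x a -> ~ x b.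
Proof. by rewrite eq0P; split=> H x; have := H x; rewrite ptI; tauto. Qed.

Lemma countableU (T : Type) (A B : set T) :
  countable A -> countable B -> countable (A `|` B)%classic.
Proof.
move=> cA cB; have -> : (A `|` B = \bigcup_(e in [set: bool]) if e then A else B)%classic.
  apply/seteqP; split=> [t [?|?]|t [[] _ ?]].
  - by exists true.
  - by exists false.
  - by left.
  - by right.
by apply: bigcup_countable => [|[]//]; exact: countableP.
Qed.

Lemma countableU1 (T : Type) (A : set T) (t : T) :
  countable A -> countable (t |` A)%classic.
Proof. by apply: countableU; exact: countable1. Qed.

Lemma countable_image (T U : Type) (f : T -> U) (A : set T) :
  countable A -> countable (f @` A)%classic.
Proof. by move=> cA; apply: card_le_trans cA; exact: card_image_le. Qed.

(** No countable gaps: [C] is the union over [i] of [l i] minus [m 0], ..., [m i], so each error is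
    covered by finitely many intersections of an [l i] with an [m j], all of them finite. *)
Lemma separation_seq (L M : nat -> Pfin) :
  (forall i j, L i `&` M j = \bot) ->
  exists c, forall i, L i <= c /\ M i `&` c = \bot.
Proof.
move=> LM; pose l i := repr (L i); pose m i := repr (M i).
have lm i j : finite_set (l i `&` m j)%classic.
  by apply/pi0P; rewrite pi_Pfin_meet !reprK.
pose C : set nat :=
  [set n | exists i, l i n /\ forall j, (j <= i)%N -> ~ m j n].
have fin_le (F : nat -> set nat) i : (forall j, finite_set (F j)) ->
    finite_set (\bigcup_(j in `I_i) F j)%classic.
  by move=> fF; apply: bigcup_finite => // *; exact: finite_II.
exists (\pi_Pfin C) => i; split.
  rewrite -(reprK (L i)); apply/Pfin_leP.
  apply: sub_finite_set (fin_le (fun j => l i `&` m j)%classic i.+1 (lm i)).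
  move=> n [lin nC]; apply: contrapT => N; apply: nC; exists i; split=> // j ji mj.
  by apply: N; exists j.
rewrite -(reprK (M i)) -pi_Pfin_meet; apply/pi0P.
apply: sub_finite_set (fin_le (fun j => l j `&` m i)%classic i (lm^~ i)).
move=> n [min [j [lj H]]]; exists j => //=.
by rewrite ltnNge; apply/negP => /H.
Qed.

Lemma separation (L M : set Pfin) : countable L -> countable M ->
  (forall a b, L a -> M b -> a `&` b = \bot) ->
  exists c, (forall a, L a -> a <= c) /\ (forall b, M b -> b `&` c = \bot).
Proof.
move=> cL cM LM.
have pad (S : set Pfin) : countable S -> exists f : nat -> Pfin,
    (forall n, S (f n) \/ f n = \bot) /\ forall s, S s -> exists n, f n = s.
  move=> cS; have [[s Ss]|S0] := pselect (exists s, S s).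
    have [f ->] := countable_range cS Ss; exists f.
    by split=> [n|_ [n _ <-]]; [left; exists n|exists n].
  exists (fun _ => \bot); split=> [|s Ss]; first by right.
  by case: S0; exists s.
have [l [lL Ll]] := pad _ cL; have [m [mM Mm]] := pad _ cM.
have [|c Hc] := @separation_seq l m.
  move=> i j; case: (lL i) => [?|->]; last by rewrite meet0x.
  by case: (mM j) => [?|->]; [exact: LM|rewrite meetx0].
exists c; split=> [a /Ll[n <-]|b /Mm[n <-]]; by case: (Hc n).
Qed.

Lemma finite_nat_bound (A : set nat) :
  finite_set A -> exists m, forall n, A n -> (n < m)%N.
Proof.
move=> /finite_seqP[s ->]; elim: s => [|k s [m IH]]; first by exists 0%N.
exists (maxn k.+1 m) => n /=; rewrite inE => /orP[/eqP->|ns].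
  by rewrite leq_max leqnn.
by rewrite leq_max IH ?orbT.
Qed.

(** A pseudo-intersection: [g n] is a common member of the first [n + 1] sets, and [n <= g n] makes
    its range infinite. *)
Lemma lower_bound_seq (f : nat -> Pfin) :
  (forall n, exists x, forall i, (i <= n)%N -> x (f i)) ->
  exists p, p != \bot /\ forall n, p <= f n.
Proof.
move=> H.
have /choice[g Hg] n : exists k, (n <= k)%N /\
    forall i, (i <= n)%N -> repr (f i) k.
  have [x Hx] := H n.
  have {Hx} : x (\pi_Pfin (\bigcap_(i in `I_n.+1) repr (f i))%classic).
    elim: n Hx {H} => [|n IH] Hx.
      suff -> : (\bigcap_(i in `I_1) repr (f i) = repr (f 0%N))%classic.
        by rewrite reprK; apply: Hx.
      apply/seteqP; split=> [k Hk|k Hk [|//]//]; exact: (Hk 0%N).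
    suff -> : (\bigcap_(i in `I_n.+2) repr (f i) =
        (\bigcap_(i in `I_n.+1) repr (f i)) `&` repr (f n.+1))%classic.
      rewrite pi_Pfin_meet ptI reprK; split; last exact: Hx.
      by apply: IH => i ilen; apply: Hx; exact: leqW.
    apply/seteqP; split=> [k Hk|k [Hk kn] i /=].
      by split=> [i /= ilt|]; apply: Hk => //=; exact: ltnW.
    by rewrite ltnS leq_eqVlt => /orP[/eqP->//|]; exact: Hk.
  move=> xA; have iA : infinite_set (\bigcap_(i in `I_n.+1) repr (f i))%classic.
    by move=> /pi0P E; move: xA; rewrite E => /pt0.
  have [k [Ak nk]] : ((\bigcap_(i in `I_n.+1) repr (f i)) `\` `I_n)%classic !=set0.
    by apply: infinite_setN0; apply: infinite_setD => //; exact: finite_II.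
  exists k; split; last by move=> i ilen; apply: Ak.
  by rewrite leqNgt; apply/negP.
exists (\pi_Pfin (range g)); split.
  apply/eqP => /pi0P/finite_nat_bound[m Hm].
  by have := Hm _ (ex_intro2 _ _ m I erefl); rewrite ltnNge (Hg m).1.
move=> i; rewrite -(reprK (f i)); apply/Pfin_leP.
apply: sub_finite_set (finite_image g (finite_II i)) => _ [[n _ <-] nf].
by exists n => //=; rewrite ltnNge; apply/negP => /(Hg n).2/nf.
Qed.

Lemma lower_bound (S : set Pfin) : countable S ->
  (forall s : seq Pfin, (forall a, a \in s -> S a) ->
     exists x, forall a, a \in s -> x a) ->
  exists p, p != \bot /\ forall a, S a -> p <= a.
Proof.
move=> cS H.
(* Adding [\top] makes the set nonempty, hence the range of a sequence. *)
have cS' : countable (\top |` S)%classic.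
  exact: countableU1.
have [f Ef] := countable_range cS' (or_introl erefl : (\top |` S)%classic \top).
have fS n : S (f n) \/ f n = \top.
  have : range f (f n) by exists n.
  by rewrite -Ef => -[/= ->|Sf]; [right|left].
have [|p [p0 pf]] := @lower_bound_seq f.
  move=> n; have [|x Hx] := H [seq f i | i <- iota 0 n.+1 & `[< S (f i) >]].
    by move=> a /mapP[i]; rewrite mem_filter => /andP[/asboolP ? _] ->.
  exists x => i ilen; have [Si|->] := fS i; last exact: pt1.
  apply: Hx; apply/mapP; exists i => //.
  by rewrite mem_filter mem_iota add0n ltnS ilen !andbT; apply/asboolP.
exists p; split=> // a Sa; have : range f a by rewrite -Ef; right.
by case=> n _ <-.
Qed.

(** The even-indexed and odd-indexed terms of an injective sequence in [A] give the two parts. *)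
Lemma split_nonzero a : a != \bot ->
  exists b c, [/\ b != \bot, c != \bot, b <= a, c <= a & b `&` c = \bot].
Proof.
elim/quotW: a => A /eqP nA; have iA : infinite_set A by move/pi0P.
have /infiniteP/ppcard_leP[f] := iA.
have finj : injective f by move=> i j; apply: (@inj _ _ _ f); rewrite inE.
have fA n : A (f n) by exact: funS.
pose P (e : bool) := [set f (e + n.*2) | n in [set: nat]].
have iP e : \pi_Pfin (P e) != \bot.
  apply/eqP/pi0P => fP; apply: infinite_nat.
  apply: sub_finite_set (@finite_preimage _ _ (P e) (fun n => f (e + n.*2)%N) _ fP).
    by move=> n _; exists n.
  by move=> m n _ _ /finj/addnI/double_inj.
have PA e : \pi_Pfin (P e) <= \pi_Pfin A.
  by apply/Pfin_leP; apply: sub_finite_set (finite_set0 nat) => _ [[n _ <-]].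
exists (\pi_Pfin (P true)), (\pi_Pfin (P false)); split=> //.
rewrite -pi_Pfin_meet; apply/pi0P; apply: sub_finite_set (finite_set0 nat).
move=> _ [[m _ <-] [n _ /finj]] /(congr1 odd).
by rewrite add0n oddD !odd_double.
Qed.

(** Fix a point [x] of [a]. Of two disjoint parts of [p] at least one misses [x]; its complement is
    [s p], and [b] is a lower bound of [a] and all [s p]. *)
Lemma avoid_above a (P : set Pfin) : a != \bot -> countable P ->
  (forall p, P p -> p != \bot) ->
  exists b, [/\ b != \bot, b <= a & forall p, P p -> ~ (p <= b)].
Proof.
move=> a0 cP P0; have [x xa] := pt_ex a0.
have /choice[s Hs] p : exists b, x b /\ (P p -> ~ (p <= b)).
  have [Pp|nP] := pselect (P p); last by exists a.
  have [b [c [/pt_ex[y yb] /pt_ex[z zc] bp cp /meet0P bc]]] := split_nonzero (P0 _ Pp).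
  have [xb|nxb] := pselect (x b).
    exists (~` c); split=> [|_]; first by rewrite ptC; exact: bc.
    by apply/nlePt; exists z; rewrite ptC; split; [exact: ptW zc|case].
  exists (~` b); split=> [|_]; first by rewrite ptC.
  by apply/nlePt; exists y; rewrite ptC; split; [exact: ptW yb|case].
have [||b [b0 bS]] := @lower_bound (a |` s @` P)%classic.
- by apply: countableU1; exact: countable_image.
- move=> t Ht; exists x => b /Ht[->//|[p _ <-]]; exact: (Hs p).1.
exists b; split=> // [|p Pp pb]; first by apply: bS; left.
by apply: ((Hs p).2 Pp); apply: le_trans pb _; apply: bS; right; exists p.
Qed.

(** Greedy recursion: [F t] is a part of the first remaining element that contains no remaining
    element, so removing it leaves all later elements nonzero. *)
Lemma disjoint_refinement (f : nat -> Pfin) : (forall n, f n != \bot) ->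
  exists g : nat -> Pfin, (forall n, g n != \bot /\ g n <= f n) /\
    forall m n, m <> n -> g m `&` g n = \bot.
Proof.
move=> f0.
have /choice[F HF] (t : nat -> Pfin) : exists b, (forall n, t n != \bot) ->
    [/\ b != \bot, b <= t 0%N & forall n, ~ (t n <= b)].
  have [t0|nt] := pselect (forall n, t n != \bot); last by exists \bot.
  have [|p [n _ <-]//|b [b0 bt Hb]] := avoid_above (t0 0%N) (_ : countable (range t)).
    by apply: countable_image; exact: countableP.
  by exists b => _; split=> // n; apply: Hb; exists n.
pose next t n := t n.+1 `\` F t : Pfin.
pose T k := iter k next f.
have T0 k n : T k n != \bot.
  elim: k n => // k IH n; rewrite /T iterS -/(T k).
  have [_ _ H] := HF _ IH; have /nlePt[x [xT nxF]] := H n.+1.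
  by apply/eqP/neq0P; exists x; rewrite ptD.
have Tle k j n : (k <= j)%N -> T j n <= T k (n + (j - k))%N.
  move=> kj; rewrite -{1}(subnKC kj) addnC; elim: (j - k)%N n => [|i IH] n.
    by rewrite addn0.
  rewrite addSn /T iterS -/(T _) /next; apply: le_trans (leBx _ _) _.
  by rewrite addnS -addSn; exact: IH.
exists (fun k => F (T k)); split=> [k|].
  have [F0 FT _] := HF _ (T0 k); split=> //.
  by apply: le_trans FT _; have := Tle 0%N k 0%N (leq0n k); rewrite add0n subn0.
suff D m n : (m < n)%N -> F (T m) `&` F (T n) = \bot.
  by move=> m n /eqP; rewrite neq_ltn => /orP[/D//|/D]; rewrite meetC.
move=> mn; apply/meet0P => x xm xn.
have [_ FT _] := HF _ (T0 n).
have := ptW (Tle m.+1 n 0%N mn) (ptW FT xn).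
by rewrite /T iterS -/(T m) /next ptD => -[].
Qed.
(** As [M] is closed under joins, the differences of [p] with its elements have the finite
    intersection property; saturation supplies [r]. *)
Lemma avoid_ideal p (M : set Pfin) : countable M -> M \bot ->
  (forall a b, M a -> M b -> M (a `|` b)) -> (forall m, M m -> ~ (p <= m)) ->
  exists r, [/\ r != \bot, r <= p & forall m, M m -> m `&` r = \bot].
Proof.
move=> cM M0 MU pM.
have [||r [r0 rM]] := @lower_bound [set p `\` m | m in M].
- exact: countable_image.
- move=> s Hs; suff [m [Mm Hm]] : exists m, M m /\ forall a, a \in s -> p `\` m <= a.
    have /nlePt[x [xp xm]] := pM _ Mm.
    by exists x => a /Hm pa; apply: (ptW pa); apply/ptD.
  elim: s Hs => [|a s IH] Hs; first by exists \bot.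
  have [|m [Mm Hm]] := IH; first by move=> b bs; apply: Hs; rewrite inE bs orbT.
  have [n Mn <-] := Hs a (mem_head _ _).
  exists (n `|` m); split=> [|b]; first exact: MU.
  rewrite inE => /orP[/eqP->|/Hm]; last apply: le_trans.
    by apply/lePt => x; rewrite !ptD ptU; tauto.
  by apply/lePt => x; rewrite !ptD ptU; tauto.
exists r; split=> // [|m Mm].
  by apply: le_trans (rM _ (ex_intro2 _ _ _ M0 erefl)) _; exact: leBx.
apply/meet0P => x xm xr; have := ptW (rM _ (ex_intro2 _ _ _ Mm erefl)) xr.
by rewrite ptD => -[].
Qed.

Lemma disjoint_refinement_set (T : Type) (S : set T) (f : T -> Pfin) :
  countable S -> (forall t, S t -> f t != \bot) ->
  exists g : T -> Pfin, (forall t, S t -> g t != \bot /\ g t <= f t) /\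
    forall t u, S t -> S u -> t <> u -> g t `&` g u = \bot.
Proof.
move=> /countable_injP[h hinj] f0.
have /choice[f' Hf'] n : exists v, v != \bot /\ forall t, S t -> h t = n -> v = f t.
  have [[t [St <-]]|N] := pselect (exists t, S t /\ h t = n).
    exists (f t); split=> [|u Su hu]; first exact: f0.
    by congr f; apply: hinj; rewrite ?inE.
  exists \top; split; last by move=> t St ht; case: N; exists t.
  by apply/eqP/pi0P; exact: infinite_nat.
have [|g [g0 gD]] := @disjoint_refinement f'; first by move=> n; case: (Hf' n).
exists (g \o h); split=> [t St /=|t u St Su tu /=].
  by have [? ?] := g0 (h t); rewrite -((Hf' (h t)).2 t St erefl).
by apply: gD => /hinj; rewrite !inE => /(_ St Su).
Qed.

(** Each element of [P] has a nonzero part disjoint from all of [M], each element of [Q] one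
    disjoint from all of [L]. Once these parts are pairwise disjoint, the former join [L], the
    latter join [M], and the enlarged families are separated. *)
Lemma free_interpolant (L M P Q : set Pfin) :
  countable L -> countable M -> countable P -> countable Q ->
  L \bot -> (forall a b, L a -> L b -> L (a `|` b)) ->
  M \bot -> (forall a b, M a -> M b -> M (a `|` b)) ->
  (forall a b, L a -> M b -> a `&` b = \bot) ->
  (forall p m, P p -> M m -> ~ (p <= m)) -> (forall p l, Q p -> L l -> ~ (p <= l)) ->
  exists d, [/\ forall l, L l -> l <= d, forall m, M m -> m `&` d = \bot,
    forall p, P p -> p `&` d <> \bot & forall p, Q p -> ~ (p <= d)].
Proof.
move=> cL cM cP cQ L0 LU M0 MU LM PM QL.
(* The tag keeps apart the two roles of an element lying in both [P] and [Q]. *)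
pose S : set (bool * Pfin) := [set t | if t.1 then P t.2 else Q t.2].
have cS : countable S.
  apply: (@sub_countable _ _ _ ((fun p => (true, p)) @` P `|` (fun p => (false, p)) @` Q)).
    by apply: subset_card_le => -[[] p] /= H; [left|right]; exists p.
  by apply: countableU; exact: countable_image.
have /choice[f Hf] (t : bool * Pfin) : exists r, S t -> [/\ r != \bot, r <= t.2 &
    forall m, (if t.1 then M m else L m) -> m `&` r = \bot].
  case: t => [[] p] /=; rewrite /S /=.
    have [Pp|nP] := pselect (P p); last by exists \bot.
    by have [r Hr] := avoid_ideal cM M0 MU (PM p ^~ Pp); exists r.
  have [Qp|nQ] := pselect (Q p); last by exists \bot.
  by have [r Hr] := avoid_ideal cL L0 LU (QL p ^~ Qp); exists r.
have [|g [g0 gD]] := disjoint_refinement_set (f := f) cS.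
  by move=> t /Hf[].
have gM (e : bool) p m : S (e, p) -> (if e then M m else L m) -> m `&` g (e, p) = \bot.
  move=> Sp Mm; apply/meet0P => x xm xg.
  have [_ _ /(_ m Mm)/meet0P H] := Hf _ Sp; apply: H xm _.
  by apply: ptW xg; case: (g0 _ Sp).
have [|||d [Ld Md]] := @separation (L `|` [set g (true, p) | p in P])
  (M `|` [set g (false, p) | p in Q]).
- by apply: countableU => //; exact: countable_image.
- by apply: countableU => //; exact: countable_image.
- move=> a b [La|[p Pp <-]] [Mb|[q Qq <-]].
  + exact: LM.
  + exact: gM.
  + by rewrite meetC; exact: gM.
  + by apply: gD.
exists d; split=> [l Ll|m Mm|p Pp|p Qp].
- by apply: Ld; left.
- by apply: Md; left.
- have [/pt_ex[x xg] gf] := g0 (true, p) Pp; apply/neq0P; exists x.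
  rewrite ptI; split; last by apply: ptW xg; apply: Ld; right; exists p.
  by have [_ fp _] := Hf (true, p) Pp; exact: ptW fp (ptW gf xg).
have [/pt_ex[x xg] gf] := g0 (false, p) Qp; apply/nlePt; exists x.
have [_ fp _] := Hf (false, p) Qp; split; first exact: ptW fp (ptW gf xg).
by have /meet0P/(_ x xg) := Md _ (or_intror (ex_intro2 _ _ p Qp erefl)).
Qed.

(** * Transfinite constructions under CH *)

(** If a well-order of the continuum has an uncountable initial segment, CH makes the least such
    segment equinumerous with the continuum, and its order is pulled back along a bijection. *)
Lemma CH_well_order : CH -> exists lt : set nat -> set nat -> Prop,
  [/\ well_founded lt, forall s t, s <> t -> lt s t \/ lt t s
    & forall s, countable [set t | lt t s]].
Proof.
move=> ch; have [R Rwo] := wochoice.well_ordering_principle (set nat).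
have Rmin (A : set (set nat)) s : A s -> exists2 z, A z & forall t, A t -> R z t.
  move=> As; have [|z [[/asboolP Az zmin] _]] := Rwo (fun t => `[< A t >]).
    by exists s; apply/asboolP.
  by exists z => // t At; apply: zmin; apply/asboolP.
have Ranti s t : R s t -> R t s -> s = t.
  move=> st ts; have Rr u : R u u by have [_ -> /(_ u erefl)] := Rmin [set u] u erefl.
  have [|z [_ U]] := Rwo (pred2 s t); first by exists s; rewrite inE eqxx.
  rewrite -(U s) ?(U t) //; split; rewrite ?inE ?eqxx ?orbT // => u;
    by rewrite inE => /orP[] /eqP->.
pose lt s t := R s t /\ s <> t.
have lt_total s t : s <> t -> lt s t \/ lt t s.
  move=> st; have [z [->|->] H] := Rmin [set s; t] s (or_introl erefl).
    by left; split=> //; apply: H; right.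
  by right; split=> [|/esym//]; apply: H; left.
have lt_wf : well_founded lt.
  move=> s; apply: contrapT => ns.
  have [z nz zmin] := Rmin [set s | ~ Acc lt s] s ns.
  apply: nz; constructor => t [tz ntz]; apply: contrapT => /zmin zt.
  by apply: ntz; exact: Ranti.
have [H|/existsNP[s /(Rmin [set s | ~ countable [set t | lt t s]])]] :=
    pselect (forall s, countable [set t | lt t s]); first by exists lt.
move=> [z nz zmin]; case: (ch [set t | lt t z]) => // /card_esym.
move=> /card_set_bijP[f [fz finj _]].
exists (fun s t => lt (f s) (f t)); split.
- move=> t; move E: (f t) => u; elim: u / (lt_wf u) t E => u _ IH t E.
  by constructor => v; rewrite E => /IH Iv; exact: Iv.
- by move=> t u tu; apply: lt_total => /finj; rewrite !inE => /(_ I I).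
- move=> t; apply: (@sub_countable _ _ _ [set u | lt u (f t)]).
    apply: (@card_ge_preimage _ _ [set u | lt u (f t)] f).
    by move=> u v _ _; apply: finj; rewrite inE.
  apply: contrapT => /zmin zt; have [tz ntz] := fz t I.
  by apply: ntz; exact: Ranti.
Qed.

(** Transfinite recursion where the choice at [i] sees only the set of earlier values; [x0] is the
    value when no choice is admissible. *)
Lemma wf_select (I X : Type) (lt : I -> I -> Prop) (x0 : X)
    (Q : I -> set X -> X -> Prop) : well_founded lt ->
  exists f : I -> X, forall i, let S := [set f j | j in [set j | lt j i]] in
    (exists t, Q i S t) -> Q i S (f i).
Proof.
move=> lt_wf.
pose F i (rec : forall j, lt j i -> X) : X :=
  let S := [set t | exists j (ji : lt j i), rec j ji = t] in
  if pselect (exists t, Q i S t) is left h then projT1 (cid h) else x0.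
exists (Fix lt_wf (fun _ => X) F) => i S Qi.
have FE : Fix lt_wf (fun _ => X) F i = F i (fun j _ => Fix lt_wf (fun _ => X) F j).
  apply: Fix_eq => j f g fg; suff -> : f = g by [].
  by apply: functional_extensionality_dep => k; apply: functional_extensionality_dep.
have ES : [set t | exists j (ji : lt j i), Fix lt_wf (fun _ => X) F j = t] = S.
  by apply/seteqP; split=> [t [j [ji E]]|t [j ji E]]; exists j.
rewrite FE /F ES; case: pselect => [h|//]; exact: (projT2 (cid h)).
Qed.

(** Nonempty and of size at most the continuum, in the form transfinite constructions use: [f] lists
    the tasks, possibly with repetitions. *)
Definition continuum_image (T : Type) : Prop :=
  exists f : set nat -> T, forall t, exists s, f s = t.

Lemma ci_image (T U : Type) (f : T -> U) : (forall u, exists t, f t = u) ->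
  continuum_image T -> continuum_image U.
Proof.
move=> fs [g gs]; exists (f \o g) => u.
by have [t <-] := fs u; have [s <-] := gs t; exists s.
Qed.

Lemma ci_set : continuum_image (set nat). Proof. by exists id => s; exists s. Qed.

Lemma ci_Pfin : continuum_image Pfin.
Proof. by exists (fun A => \pi_Pfin A); elim/quotW=> A; exists A. Qed.

Lemma ci_nat : continuum_image nat.
Proof.
exists (fun s => xget 0%N s) => n; exists [set n].
by case: xgetP => [m _ ->//|/(_ n)] //=; case.
Qed.

Lemma ci_seq (T : Type) : continuum_image T -> continuum_image (nat -> T).
Proof.
move=> [g gs].
exists (fun s n => g [set k | s (pickle (n, k))]) => u.
have /choice[v vu] n : exists s, g s = u n by exact: gs.
exists [set m | exists n k, m = pickle (n, k) /\ v n k].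
apply/funext => n; rewrite -vu; congr g; apply/seteqP; split=> k /=.
  by move=> [m [l [/(pcan_inj pickleK)[-> ->]]]].
by move=> vk; exists n, k.
Qed.

Lemma ci_prod (T U : Type) : continuum_image T -> continuum_image U ->
  continuum_image (T * U).
Proof.
move=> [f fs] [g gs].
apply: (@ci_image _ _ (fun w : nat -> set nat => (f (w 0%N), g (w 1%N)))).
  move=> [t u]; have [s <-] := fs t; have [r <-] := gs u.
  by exists (fun n => if n is 0%N then s else r).
by apply: ci_seq; exact: ci_set.
Qed.

Lemma ci_sum (T U : Type) : continuum_image T -> continuum_image U ->
  continuum_image (T + U).
Proof.
move=> cT cU.
apply: (@ci_image _ _
  (fun w : nat * (T * U) => if w.1 is 0%N then inl w.2.1 else inr w.2.2)).
  have [f _] := cT; have [g _] := cU.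
  by move=> [t|u]; [exists (0%N, (t, g set0))|exists (1%N, (f set0, u))].
by apply: ci_prod; [exact: ci_nat|exact: ci_prod].
Qed.

(* Martin's axiom for sigma-closed posets and aleph_1 dense sets. *)
Lemma sigma_closed_generic (P T : Type) (le : P -> P -> Prop) (D : T -> set P)
    (u0 : P) : CH -> continuum_image T ->
  (forall u, le u u) -> (forall u v w, le u v -> le v w -> le u w) ->
  (forall S : set P, countable S -> S !=set0 ->
     (forall u v, S u -> S v -> le u v \/ le v u) ->
     exists v, forall u, S u -> le u v) ->
  (forall t u, exists v, le u v /\ D t v) ->
  exists K : set P, [/\ forall u, K u -> le u0 u,
    forall u v, K u -> K v -> le u v \/ le v u
    & forall t, exists u, K u /\ D t u].
Proof.
move=> ch [task task_surj] lerefl letrans lebound Ddense.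
have [lt [lt_wf lt_total lt_ctbl]] := CH_well_order ch.
pose Q (i : set nat) (S : set P) (v : P) :=
  [/\ le u0 v, forall u, S u -> le u v & D (task i) v].
have [f Hf] := wf_select u0 Q lt_wf.
have fQ i : Q i [set f j | j in [set j | lt j i]] (f i).
  elim: i / (lt_wf i) => i _ IH; apply: Hf.
  set S := [set f j | j in _].
  (* The earlier stages form a countable chain; [u0] keeps it nonempty at the first stage. *)
  have [||u v [->|[j ji <-]] [->|[k ki <-]]|v vb] := lebound (u0 |` S)%classic.
  - by apply: countableU1; exact: countable_image.
  - by exists u0; left.
  - by left.
  - by left; case: (IH k ki).
  - by right; case: (IH j ji).
  - have [->|/eqP] := eqVneq j k; first by left.
    by move=> /lt_total[jk|kj]; [left|right];
      [have [_ H _] := IH k ki; apply: H; exists j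
      |have [_ H _] := IH j ji; apply: H; exists k].
  have [w [vw Dw]] := Ddense (task i) v; exists w; split=> // [|u Su].
    by apply: letrans vw; apply: vb; left.
  by apply: letrans vw; apply: vb; right.
exists (range f); split=> [_ [i _ <-]|_ _ [j _ <-] [k _ <-]|t].
- by case: (fQ i).
- have [->|/eqP] := eqVneq j k; first by left.
  by move=> /lt_total[jk|kj]; [left|right];
    [have [_ H _] := fQ k; apply: H; exists j
    |have [_ H _] := fQ j; apply: H; exists k].
- have [i <-] := task_surj t; exists (f i); split; first by exists i.
  by case: (fQ i).
Qed.
(** * P-points *)

(** Forcing with nonzero elements, smaller ones being stronger. The extra tasks [inr c] decide every
    [c], so the generic chain generates an ultrafilter. *)
Lemma generic_point (T : Type) (E : T -> set Pfin) a : CH ->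
  continuum_image T -> a != \bot ->
  (forall t p, p != \bot -> exists q, [/\ q != \bot, q <= p & E t q]) ->
  exists x, x a /\ forall t, exists q, x q /\ E t q.
Proof.
move=> ch cT a0 dense.
pose P := {p : Pfin | p != \bot}.
pose D (t : T + Pfin) : set P :=
  match t with
  | inl t => [set u | E t (val u)]
  | inr c => [set u | val u <= c \/ val u <= ~` c]
  end.
have [|||||K [Ka Kchain KD]] := @sigma_closed_generic P (T + Pfin)
    (fun u v => val v <= val u) D (exist _ a a0) ch.
- by apply: ci_sum => //; exact: ci_Pfin.
- by [].
- by move=> u v w vu wv; exact: le_trans wv vu.
- move=> S cS [s0 Ss0] chain.
  have [||p [p0 pS]] := @lower_bound [set val u | u in S].
  + exact: countable_image.
  + move=> s Hs; suff [u [Su Hu]] : exists u, S u /\ forall b, b \in s -> val u <= b.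
      by have [x xu] := pt_ex (valP u); exists x => b /Hu ub; exact: ptW ub xu.
    elim: s Hs => [|b s IH] Hs; first by exists s0.
    have [|u [Su Hu]] := IH; first by move=> c cs; apply: Hs; rewrite inE cs orbT.
    have [v Sv vb] := Hs b (mem_head _ _).
    have [uv|vu] := chain u v Su Sv.
      exists v; split=> // c; rewrite inE => /orP[/eqP->|/Hu]; first by rewrite vb.
      exact: le_trans.
    exists u; split=> // c; rewrite inE => /orP[/eqP->|/Hu//].
    by rewrite -vb.
  by exists (exist (fun r => r != \bot) p p0) => u Su; apply: pS; exists u.
- case=> [t|c] [p p0].
    by have [q [q0 qp Eq]] := dense t p p0; exists (exist (fun r => r != \bot) q q0).
  have [x xp] := pt_ex p0; have [xc|nxc] := pselect (x c).
    have pc0 : p `&` c != \bot by apply/eqP/neq0P; exists x; apply/ptI.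
    by exists (exist (fun r => r != \bot) _ pc0); split=> /=; [exact: leIl|left; exact: leIr].
  have pc0 : p `&` ~` c != \bot.
    by apply/eqP/neq0P; exists x; apply/ptI; rewrite ptC.
  by exists (exist (fun r => r != \bot) _ pc0); split=> /=; [exact: leIl|right; exact: leIr].
have xP : is_point [set c | exists u, K u /\ val u <= c].
  split.
  - by move=> [[p p0] [_ /=]]; rewrite lex0 => /eqP E0; rewrite E0 eqxx in p0.
  - move=> b c; split=> [[u [Ku]]|[[u [Ku ub]] [v [Kv vc]]]].
      by rewrite lexI => /andP[ub uc]; split; exists u.
    have [vu|uv] := Kchain u v Ku Kv.
      by exists v; rewrite lexI vc (le_trans vu ub).
    by exists u; rewrite lexI ub (le_trans uv vc).
  - move=> c; split=> [[u [Ku uc]] [v [Kv vc]]|nc].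
      have [w [w0 wu wv]] : exists w, [/\ w != \bot, w <= val u & w <= val v].
        have [vu|uv] := Kchain u v Ku Kv.
          by exists (val v); split=> //; exact: (valP v).
        by exists (val u); split=> //; exact: (valP u).
      have [x xw] := pt_ex w0; have := ptW (le_trans wu uc) xw.
      by move=> /ptC[]; exact: ptW (le_trans wv vc) xw.
    have [u [Ku [uc|uc]]] := KD (inr c); last by exists u.
    by case: nc; exists u.
exists (Pt xP); split=> [|t].
  by have [u [Ku _]] := KD (inr \bot); exists u; split=> //; exact: Ka Ku.
by have [u [Ku Eu]] := KD (inl t); exists (val u); split=> //; exists u.
Qed.

Definition ppoint x : Prop := forall s : nat -> Pfin,
  (forall n, x (s n)) -> exists p, x p /\ forall n, p <= s n.

Lemma ppoint_countable x (S : set Pfin) : ppoint x -> countable S ->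
  (forall a, S a -> x a) -> exists p, x p /\ forall a, S a -> p <= a.
Proof.
move=> Px cS xS; have [f Ef] := @countable_range _ (\top |` S)%classic _
  (countableU1 _ cS) (or_introl erefl : (\top |` S)%classic \top).
have [|p [xp pf]] := Px f.
  move=> n; have : range f (f n) by exists n.
  by rewrite -Ef => -[/= ->|/xS//]; exact: pt1.
exists p; split=> // a Sa.
by have : range f a by [rewrite -Ef; right]; case=> n _ <-.
Qed.

(** Density of the tasks that make a generic point a P-point: if [p] minus some [s n] is nonzero, it
    serves as [q]; otherwise every point of [p] lies in all [s n]. *)
Lemma decide_seq (s : nat -> Pfin) p : p != \bot ->
  exists q, [/\ q != \bot, q <= p
    & (forall n, q <= s n) \/ exists n, q `&` s n = \bot].
Proof.
move=> p0; have [[q H]|N] := pselect (exists q, [/\ q != \bot, q <= p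
    & exists n, q `&` s n = \bot]).
  by exists q; case: H => ? ? ?; split=> //; right.
have [|q [q0 qs]] := @lower_bound_seq (fun n => if n is m.+1 then s m else p).
  have [x xp] := pt_ex p0; move=> n; exists x => -[|i] // _.
  apply: contrapT => nx; apply: N; exists (p `\` s i); split.
  - by apply/eqP/neq0P; exists x; apply/ptD.
  - exact: leBx.
  - by exists i; exact: diffIK.
by exists q; split; [|exact: qs 0%N|left=> n; exact: qs n.+1].
Qed.

(** The [V t] are families to be avoided. None contains two complementary sets, so of two disjoint
    parts of [p] one is included in a set outside [V t]. *)
Lemma ppoint_ex (T : Type) (V : T -> set (set nat)) b : CH ->
  continuum_image T -> b != \bot ->
  (forall t A, ~ (V t A /\ V t (~` A)%classic)) ->
  exists x, [/\ ppoint x, x b & forall t, exists A, x (\pi_Pfin A) /\ ~ V t A].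
Proof.
move=> ch cT b0 VC.
pose E (t : T + (nat -> Pfin)) : set Pfin :=
  match t with
  | inl t => [set q | exists A, q <= \pi_Pfin A /\ ~ V t A]
  | inr s => [set q | (forall n, q <= s n) \/ exists n, q `&` s n = \bot]
  end.
have [|[t|s] p p0|x [xb xE]] := @generic_point _ E b ch _ b0.
- by apply: ci_sum => //; exact/ci_seq/ci_Pfin.
- have [c [d [c0 d0 cp dp cd]]] := split_nonzero p0.
  have [Vc|nVc] := pselect (V t (repr c)).
    exists d; split=> //; exists (~` repr c)%classic; split; last first.
      by move=> ?; apply: (VC t (repr c)).
    rewrite pi_Pfin_setC reprK; apply/lePt => x xd; rewrite ptC => xc.
    by move/meet0P : cd => /(_ x xc).
  by exists c; split=> //; exists (repr c); rewrite reprK.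
- exact: decide_seq.
exists x; split=> // [s xs|t].
  have [q [xq [qs|[n /meet0P qn]]]] := xE (inr s); first by exists q.
  by have := qn x xq (xs n).
have [q [xq [A [qA nA]]]] := xE (inl t); exists A; split=> //; exact: ptW xq.
Qed.

(** Each P-point [x] in [Y] has a member [p x] missing all of [Z]; each [z] in [Z] then has a member
    [q z] disjoint from every [p x]; these two countable families are separated. *)
Lemma ppoint_separation (Y Z : set pt) : countable Y -> countable Z ->
  (forall x, Y x -> ppoint x) -> (forall z, Z z -> ppoint z) ->
  (forall x z, Y x -> Z z -> x <> z) ->
  exists a, (forall x, Y x -> x a) /\ (forall z, Z z -> ~ z a).
Proof.
move=> cY cZ PY PZ YZ.
have /choice[p Hp] x : exists p, Y x -> x p /\ forall z, Z z -> ~ z p.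
  have [Yx|nY] := pselect (Y x); last by exists \bot.
  have /choice[a Ha] z : exists a, Z z -> x a /\ ~ z a.
    have [Zz|nZ] := pselect (Z z); last by exists \bot.
    apply: contrapT => N; apply: (YZ x z Yx Zz); apply: pt_ext => a xa.
    by apply: contrapT => nza; apply: N; exists a.
  have [||q [xq qa]] := @ppoint_countable x [set a z | z in Z] (PY x Yx).
  - exact: countable_image.
  - by move=> _ [z Zz <-]; case: (Ha z Zz).
  exists q => _; split=> // z Zz zq; case: (Ha z Zz) => _ [].
  by apply: ptW zq; apply: qa; exists z.
have /choice[q Hq] z : exists q, Z z -> z q /\ forall x, Y x -> q `&` p x = \bot.
  have [Zz|nZ] := pselect (Z z); last by exists \bot.
  have [||q [zq qa]] := @ppoint_countable z [set ~` p x | x in Y] (PZ z Zz).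
  - exact: countable_image.
  - by move=> _ [x Yx <-]; apply/ptC; exact: (Hp x Yx).2.
  exists q => _; split=> // x Yx; apply/meet0P => y yq yp.
  by have : q <= ~` p x by [apply: qa; exists x]; move/ptW => /(_ y yq)/ptC.
have [|||c [Yc Zc]] := @separation [set p x | x in Y] [set q z | z in Z].
- exact: countable_image.
- exact: countable_image.
- by move=> _ _ [x Yx <-] [z Zz <-]; rewrite meetC; apply: (Hq z Zz).2.
exists c; split=> [x Yx|z Zz zc].
  by apply: ptW (Hp x Yx).1; apply: Yc; exists x.
by have /meet0P/(_ z (Hq z Zz).1) := Zc _ (ex_intro2 _ _ z Zz erefl).
Qed.

(** * Limits of P-points along ultrafilters *)

Section Limit.
Variables (U : pt) (y : nat -> pt).

Lemma limit_is_point : is_point [set a | U (\pi_Pfin [set n | y n a])].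
Proof.
split=> /=.
- suff -> : [set n | y n \bot] = set0 by exact: pt0.
  by apply/seteqP; split=> n // /pt0.
- move=> a b; suff -> : [set n | y n (a `&` b)] =
      ([set n | y n a] `&` [set n | y n b])%classic by rewrite pi_Pfin_meet ptI.
  by apply/seteqP; split=> n /= /ptI.
- move=> a; suff -> : [set n | y n (~` a)] = (~` [set n | y n a])%classic.
    by rewrite pi_Pfin_setC ptC.
  by apply/seteqP; split=> n /= /ptC.
Qed.

Definition limit : pt := Pt limit_is_point.

End Limit.

(* P-points are strongly discrete, so [limit U y] determines [U] up to a
   map of [nat] (Frolik's argument). *)
Lemma limit_RK (U V : pt) (y z : nat -> pt) :
  (forall n, ppoint (y n)) -> (forall n, ppoint (z n)) -> injective z ->
  limit U y = limit V z ->
  exists f : nat -> nat, forall A, V (\pi_Pfin A) -> U (\pi_Pfin (f @^-1` A)%classic).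
Proof.
move=> Py Pz zinj E.
have lim a : U (\pi_Pfin [set n | y n a]) <-> V (\pi_Pfin [set n | z n a]).
  by have : limit U y a <-> limit V z a by rewrite E.
pose S := [set n | exists m, y n = z m].
have ctbl (A : set nat) (w : nat -> pt) : countable (w @` A)%classic.
  by apply: countable_image; exact: countableP.
have US : U (\pi_Pfin S).
  (* Otherwise [U] concentrates on indices [n] with [y n] outside the range of [z]; separating these
     points from that range makes the two limits differ. *)
  apply: contrapT; rewrite -ptC -pi_Pfin_setC => US.
  have [||x [n _ <-]|x [n _ <-]|x w [n nS <-] [m _ <-] ynm|a [ya za]] :=
    @ppoint_separation (y @` ~` S)%classic (range z); rewrite ?ctbl//.
    by apply: nS; exists m.
  suff : V (\pi_Pfin set0) by exact: pt0.
  suff <- : [set n | z n a] = set0.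
    rewrite -lim; apply: ptW US; apply/Pfin_leP.
    apply: sub_finite_set (finite_set0 nat) => n [nS nya]; apply: nya.
    by apply: ya; exists n.
  by apply/seteqP; split=> n //= zna; apply: (za (z n)) => //; exists n.
(* [f] matches indices of equal points; off [S], which [U] contains, its value [0] is arbitrary. *)
have /choice[f Hf] n : exists m, S n -> y n = z m.
  by have [[m ->]|nS] := pselect (S n); [exists m|exists 0%N].
exists f => A VA.
have [||x [n _ <-]|x [n _ <-]|x w [n An <-] [m nAm <-] /zinj nm|a [za nza]] :=
  @ppoint_separation (z @` A)%classic (z @` ~` A)%classic; rewrite ?ctbl//.
  by apply: nAm; rewrite -nm.
have : U (\pi_Pfin [set n | y n a]).
  rewrite lim; apply: ptW VA; apply/Pfin_leP.
  apply: sub_finite_set (finite_set0 nat) => n [An nzna]; apply: nzna.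
  by apply: za; exists n.
move=> Ua; have : U (\pi_Pfin [set n | y n a] `&` \pi_Pfin S) by apply/ptI.
rewrite -pi_Pfin_meet; apply: ptW; apply/Pfin_leP.
apply: sub_finite_set (finite_set0 nat) => n [[/= yna /Hf yn]]; apply.
apply: contrapT => nA; apply: (nza (z (f n))); first by exists (f n).
by rewrite -yn.
Qed.

(** By recursion [U i] is chosen different from the images of all earlier [U j] under all maps [f],
    so for two indices one of the Rudin-Keisler reductions fails. *)
Lemma RK_family : CH -> exists U : set nat -> pt, forall i j, i <> j ->
  ~ ((exists f : nat -> nat, forall A,
        U i (\pi_Pfin A) -> U j (\pi_Pfin (f @^-1` A)%classic)) /\
     (exists f : nat -> nat, forall A,
        U j (\pi_Pfin A) -> U i (\pi_Pfin (f @^-1` A)%classic))).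
Proof.
move=> ch; have [lt [lt_wf lt_total lt_ctbl]] := CH_well_order ch.
have top0 : (\top : Pfin) != \bot by apply/eqP/pi0P; exact: infinite_nat.
have [x0 _] := pt_ex top0.
pose Q (i : set nat) (S : set pt) x := forall y, S y -> forall f : nat -> nat,
  exists A, x (\pi_Pfin A) /\ ~ y (\pi_Pfin (f @^-1` A)%classic).
have [U HU] := wf_select x0 Q lt_wf.
have {HU}QU i j : lt j i -> forall f : nat -> nat,
    exists A, U i (\pi_Pfin A) /\ ~ U j (\pi_Pfin (f @^-1` A)%classic).
  move=> ji; apply: (HU i _ (U j)); last by exists j.
  pose V (t : (nat -> nat) * set nat) : set (set nat) :=
    [set A | U t.2 (\pi_Pfin (t.1 @^-1` A)%classic)].
  have [||x [_ _ Hx]] := @ppoint_ex _ V \top ch _ top0.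
  - by apply: ci_prod ci_set; apply: ci_seq; exact: ci_nat.
  - move=> [f k] A [] /=; rewrite /V /= preimage_setC pi_Pfin_setC.
    by move=> ? /ptC.
  by exists x => _ [k _ <-] f; exact: Hx (f, k).
exists U => i j /lt_total[ij|ji] [[f Hf] [g Hg]].
  by have [A [/Hg ? ?]] := QU _ _ ij g.
by have [A [/Hf ? ?]] := QU _ _ ji f.
Qed.
(** * A rigid dense family of points *)

Definition bhom (g : Pfin -> Pfin) : Prop :=
  [/\ g \bot = \bot, forall a b, g (a `&` b) = g a `&` g b
    & forall a, g (~` a) = ~` g a].

Section Pullback.
Variables (g : Pfin -> Pfin) (hom_g : bhom g).

Lemma pullback_is_point x : is_point (fun a => x (g a)).
Proof.
case: hom_g => g0 gI gC; split=> [|a b|a].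
- by rewrite g0; exact: pt0.
- by rewrite gI; exact: ptI.
- by rewrite gC; exact: ptC.
Qed.

(** The map of Stone spaces dual to [g]. *)
Definition pullback x : pt := Pt (pullback_is_point x).

Lemma pullback_inj : (forall a, exists b, g b = a) -> injective pullback.
Proof.
move=> gsurj x y E; apply: pt_ext => a; have [b <-] := gsurj a.
have Eb : pullback x b = pullback y b by rewrite E.
by move: Eb => /= ->.
Qed.

Lemma pullback_ppoint x : injective g -> (forall a, exists b, g b = a) ->
  ppoint x -> ppoint (pullback x).
Proof.
move=> ginj gsurj Px s xs; have [p [xp ps]] := Px (g \o s) xs.
have [q E] := gsurj p; exists q; split=> [|n]; first by rewrite /= E.
apply/meet_idPl/ginj; case: hom_g => _ -> _; rewrite E; apply/meet_idPl.
exact: ps.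
Qed.

Lemma pullback_limit U (y : nat -> pt) :
  pullback (limit U y) = limit U (pullback \o y).
Proof. exact: pt_ext. Qed.

End Pullback.

(** One P-point is taken in each of countably many disjoint parts of [a]. *)
Lemma ppoint_seq_ex a : CH -> a != \bot ->
  exists d : nat -> pt, [/\ injective d, forall n, ppoint (d n) & forall n, d n a].
Proof.
move=> ch a0; have [|b [b0 bD]] := @disjoint_refinement (fun=> a); first by [].
have /choice[d Hd] n : exists x, ppoint x /\ x (b n).
  have [|x [Px xb _]] := @ppoint_ex nat (fun=> set0) (b n) ch ci_nat (b0 n).1.
    by move=> t A [].
  by exists x.
exists d; split=> [m n E|n|n].
- apply: contrapT => /bD/meet0P/(_ (d m) (Hd m).2); apply.
  by rewrite E; exact: (Hd n).2.
- exact: (Hd n).1.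
- exact: ptW (b0 n).2 (Hd n).2.
Qed.

(** [X i] is the limit along [U i] of P-points in [e i], which gives density. If the dual of [g]
    carries [X i] to [X j], it carries these P-points to P-points with limit [X j]; [limit_RK] in
    both directions then contradicts the choice of [U] unless [i = j]. *)
Lemma rigid_family : CH -> exists X : set nat -> pt,
  (forall a, a != \bot -> exists i, X i a) /\
  forall (g : Pfin -> Pfin) i j, bhom g -> injective g ->
    (forall a, exists b, g b = a) -> (forall a, X j a <-> X i (g a)) -> i = j.
Proof.
move=> ch; have [e esurj] := ci_Pfin; have [U HU] := RK_family ch.
have /choice[d Hd] i : exists d : nat -> pt, [/\ injective d,
    forall n, ppoint (d n) & e i != \bot -> forall n, d n (e i)].
  have [E|ei0] := eqVneq (e i) \bot; last first.
    by have [d []] := ppoint_seq_ex ch ei0; exists d.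
  have [|d [dinj Pd _]] := @ppoint_seq_ex \top ch; last by exists d.
  by apply/eqP/pi0P; exact: infinite_nat.
exists (fun i => limit (U i) (d i)); split=> [a a0|g i j hom_g ginj gsurj Eij].
  have [i E] := esurj a; rewrite -E in a0 *; exists i => /=.
  suff -> : [set n | d i n (e i)] = setT by exact: pt1.
  by apply/seteqP; split=> // n _ /=; case: (Hd i) => _ _; exact.
have E : limit (U i) (pullback hom_g \o d i) = limit (U j) (d j).
  rewrite -pullback_limit; apply: pt_ext => a Xa; exact/Eij.
have [iinj Pi _] := Hd i; have [jinj Pj _] := Hd j.
have Pgi n : ppoint ((pullback hom_g \o d i) n) by exact: pullback_ppoint.
apply: contrapT => /HU; apply; split.
  apply: (limit_RK Pj Pgi _ (esym E)).
  by apply: inj_comp => //; exact: pullback_inj.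
exact: (limit_RK Pgi Pj jinj E).
Qed.

(** * Doubling a point *)

Definition orthogonal (L M : set Pfin) : Prop :=
  forall l m, L l -> M m -> l `&` m = \bot.

(* The open sets given by the ideals generated by [L] and [M] partition the
   complement of [{x}], and [x] lies in the closure of both. *)
Definition gap_at x (L M : set Pfin) : Prop :=
  [/\ orthogonal L M,
    forall b, ~ x b -> exists l m, [/\ L l, M m & b <= l `|` m]
  & forall s : nat -> Pfin, (forall n, x (s n)) -> exists l m,
      [/\ L l, M m, l != \bot, m != \bot & forall n, l <= s n /\ m <= s n]].

(** Forcing with countable orthogonal pairs of families of elements not in [x]. Tasks [inl b] make
    the pair cover [b]; tasks [inr s] put nonzero elements of both families below all [s n]. *)
Lemma gap_ex x : CH -> exists L M, gap_at x L M.
Proof.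
move=> ch.
pose good (u : set Pfin * set Pfin) := [/\ countable u.1, countable u.2,
  orthogonal u.1 u.2, forall a, u.1 a -> ~ x a & forall a, u.2 a -> ~ x a].
pose P := {u | good u}.
pose le (u v : P) := (sval u).1 `<=` (sval v).1 /\ (sval u).2 `<=` (sval v).2.
pose D (t : Pfin + (nat -> Pfin)) : set P := match t with
  | inl b => [set u | ~ x b -> exists l m,
      [/\ (sval u).1 l, (sval u).2 m & b <= l `|` m]]
  | inr s => [set u | (forall n, x (s n)) -> exists l m, [/\ (sval u).1 l,
      (sval u).2 m, l != \bot, m != \bot & forall n, l <= s n /\ m <= s n]]
  end.
have good0 : good (set0, set0) by split=> //=; exact: countable0.
have good_add u l m : good u -> l `&` m = \bot -> ~ x l -> ~ x m ->
    (forall a, u.1 a -> a `&` m = \bot) -> (forall a, u.2 a -> l `&` a = \bot) ->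
    good (l |` u.1, m |` u.2)%classic.
  move=> [c1 c2 o x1 x2] lm xl xm um lu; split=> /=.
  - exact: countableU1.
  - exact: countableU1.
  - by move=> a b [->|ua] [->|ub] //; [exact: lu|exact: um|exact: o].
  - by move=> a [->//|/x1].
  - by move=> a [->//|/x2].
have [|||||K [_ Kchain KD]] := @sigma_closed_generic P _ le D (exist _ _ good0) ch.
- by apply: ci_sum; [|apply: ci_seq]; exact: ci_Pfin.
- by move=> u; split.
- by move=> u v w [uv1 uv2] [vw1 vw2]; split; apply: subset_trans; eassumption.
- move=> S cS _ chain.
  have good_sup : good (\bigcup_(u in S) (sval u).1, \bigcup_(u in S) (sval u).2)%classic.
    split=> /=.
    + by apply: bigcup_countable => // u _; case: (svalP u).
    + by apply: bigcup_countable => // u _; case: (svalP u).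
    + move=> l m [u Su ul] [v Sv vm]; have [[uv _]|[_ vu]] := chain u v Su Sv.
        by case: (svalP v) => _ _ o _ _; apply: o => //; exact: uv.
      by case: (svalP u) => _ _ o _ _; apply: o => //; exact: vu.
    + by move=> a [u _ ua]; case: (svalP u) => _ _ _ + _; exact.
    + by move=> a [u _ ua]; case: (svalP u) => _ _ _ _; exact.
  by exists (exist _ _ good_sup) => u Su; split=> a ua; exists u.
- move=> t [u gu]; have [c1 c2 o x1 x2] := gu.
  have ext l m : l `&` m = \bot -> ~ x l -> ~ x m ->
      (forall a, u.1 a -> a `&` m = \bot) -> (forall a, u.2 a -> l `&` a = \bot) ->
      exists v, [/\ le (exist _ u gu) v, (sval v).1 l & (sval v).2 m].
    move=> lm xl xm um lu; exists (exist _ _ (good_add u l m gu lm xl xm um lu)).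
    by split=> /=; [split=> a ua; right|left|left].
  case: t => [b|s].
    have [xb|nxb] := pselect (x b); first by exists (exist _ u gu); split=> [|nxb]; [split|].
    (* A separator [c] of the current pair splits [b] into one new element for each side. *)
    have [c [Lc Mc]] := separation c1 c2 o.
    have [|||||v [uv vl vm]] := ext (b `&` c) (b `\` c).
    + by apply/meet0P => y /ptI[yb yc] /ptD[].
    + by move/ptI => -[].
    + by move/ptD => -[].
    + move=> a /Lc ac; apply/meet0P => y ya /ptD[_]; apply; exact: ptW ya.
    + by move=> a /Mc/meet0P ac; apply/meet0P => y /ptI[_ yc] ya; exact: ac ya yc.
    exists v; split=> // _; exists (b `&` c), (b `\` c); split=> //.
    by apply/lePt => y yb; apply/ptU; rewrite ptI ptD; case: (pselect (y c)); tauto.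
  have [xs|nxs] := pselect (forall n, x (s n)); last first.
    by exists (exist _ u gu); split=> [|xs]; [split|].
  (* [p] lies below all [s n] and is disjoint from everything in the current pair. *)
  have [||p [p0 pS]] := @lower_bound (range s `|` [set (~` a)%O | a in u.1 `|` u.2])%classic.
  + by apply: countableU; apply: countable_image; [exact: countableP|exact: countableU].
  + move=> r Hr; exists x => a /Hr[[n _ <-]//|[b [/x1|/x2] nb <-]]; exact/ptC.
  have [p1 [p2 [/eqP/neq0P[y1 y1p] p20 p1p p2p p12]]] := split_nonzero p0.
  (* Of two disjoint parts of [p] at least one is not in [x]; it is divided into the new [l] and
     [m]. *)
  have [q [q0 qp xq]] : exists q, [/\ q != \bot, q <= p & ~ x q].
    have [xp1|] := pselect (x p1).
      by exists p2; split=> // xp2; move/meet0P : p12 => /(_ x xp1).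
    by exists p1; split=> //; apply/eqP/neq0P; exists y1.
  have [l [m [l0 m0 lq mq lm]]] := split_nonzero q0.
  have disj a y : (u.1 `|` u.2)%classic a -> y q -> ~ y a.
    move=> ua yq; rewrite -ptC; apply: ptW (ptW qp yq); apply: pS.
    by right; exists a.
  have [||||v [uv vl vm]] := ext l m lm.
  + by move=> xl; apply: xq; exact: ptW xl.
  + by move=> xm; apply: xq; exact: ptW xm.
  + by move=> a ua; apply/meet0P => y ya ym; apply: (disj a y) => //; [left|exact: ptW ym].
  + by move=> a ua; apply/meet0P => y yl; apply: (disj a y) => //; [right|exact: ptW yl].
  exists v; split=> // _; exists l, m; split=> // n.
  have ps : p <= s n by apply: pS; left; exists n.
  by rewrite (le_trans lq) ?(le_trans mq)// (le_trans qp).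
exists (\bigcup_(u in K) (sval u).1)%classic, (\bigcup_(u in K) (sval u).2)%classic.
split.
- move=> l m [u Ku ul] [v Kv vm]; have [[uv _]|[_ vu]] := Kchain u v Ku Kv.
    by case: (svalP v) => _ _ o _ _; apply: o => //; exact: uv.
  by case: (svalP u) => _ _ o _ _; apply: o => //; exact: vu.
- move=> b xb; have [u [Ku /(_ xb)[l [m [ul um H]]]]] := KD (inl b).
  by exists l, m; split=> //; exists u.
- move=> s xs; have [u [Ku /(_ xs)[l [m [ul um l0 m0 H]]]]] := KD (inr s).
  by exists l, m; split=> //; exists u.
Qed.
(** * Doubling all the points of the family *)

Section Doubling.
Variables (X : set nat -> pt) (L M : set nat -> set Pfin).
Hypothesis (ch : CH) (Xinj : injective X).
Hypothesis gapX : forall i, gap_at (X i) (L i) (M i).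

(** By the gap properties this is the complement of the set of all [X i]. The enlarged algebra is
    represented by subsets of [Y], where each gap becomes a partition. *)
Definition Y := {y : pt | forall i, exists a, y a /\ (L i a \/ M i a)}.
Implicit Types (C : set Y) (u v : Y).

Definition clp a : set Y := [set y : Y | sval y a].
Definition half i : set Y := [set y : Y | exists l, L i l /\ sval y l].

(* [C] belongs to the subalgebra generated by the [clp a] and the [half i];
   this is expressed locally, at every point. *)
Definition tame C : Prop := forall x, exists b, x b /\
  forall u v, clp b u -> clp b v ->
    (forall i, x = X i -> (half i u <-> half i v)) -> (C u <-> C v).

(** [Y] is dense in the Stone space: below any [p] some nonzero element lies under a member of [L i]
    or [M i], and under CH one generic point meets these requirements for all [i]. *)
Lemma clp_neq0 a : a != \bot -> exists u, clp a u.
Proof.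
move=> a0.
pose E i : set Pfin := [set q | exists a, q <= a /\ (L i a \/ M i a)].
have [i p p0|x [xa Ex]] := @generic_point _ E a ch ci_set a0.
  have [q [q0 qp xq]] : exists q, [/\ q != \bot, q <= p & ~ X i q].
    have [b [c [b0 c0 bp cp bc]]] := split_nonzero p0.
    have [xb|] := pselect (X i b); last by exists b.
    by exists c; split=> // xc; move/meet0P : bc => /(_ _ xb).
  have [_ /(_ q xq)[l [m [Ll Mm qlm]]] _] := gapX i.
  have [z zq] := pt_ex q0; have := ptW qlm zq; rewrite ptU => -[zl|zm].
    exists (q `&` l); split; [|exact: le_trans (leIl _ _) qp|].
      by apply/eqP/neq0P; exists z; apply/ptI.
    by exists l; split; [exact: leIr|left].
  exists (q `&` m); split; [|exact: le_trans (leIl _ _) qp|].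
    by apply/eqP/neq0P; exists z; apply/ptI.
  by exists m; split; [exact: leIr|right].
have Yx i : exists a, x a /\ (L i a \/ M i a).
  by have [q [xq [c [qc Hc]]]] := Ex i; exists c; split=> //; exact: ptW xq.
by exists (exist _ x Yx).
Qed.

Lemma not_half i u : ~ half i u <-> exists m, M i m /\ sval u m.
Proof.
have [o _ _] := gapX i; split=> [ny|[m [Mm ym]] [l [Ll yl]]].
  have [a [ya [La|Ma]]] := svalP u i; last by exists a.
  by case: ny; exists a.
by have /meet0P/(_ _ yl) := o l m Ll Mm.
Qed.

Lemma tame_clp a : tame (clp a).
Proof.
move=> x; have [xa|nxa] := pselect (x a); first by exists a.
exists (~` a); rewrite ptC; split=> // y z; rewrite /clp /= !ptC; tauto.
Qed.

(** Off [X i], a member of [L i] or [M i] is a neighbourhood on which the set is all or nothing; at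
    [X i] the claim is the premise about halves. *)
Lemma tame_half i : tame (half i).
Proof.
move=> x; have [->|xX] := pselect (x = X i).
  by exists \top; split=> [|y z _ _ /(_ i erefl)//]; exact: pt1.
have [b [xb nXb]] : exists b, x b /\ ~ X i b.
  apply: contrapT => N; apply: xX; apply: pt_ext => a xa.
  by apply: contrapT => nXa; apply: N; exists a.
have [_ /(_ b nXb)[l [m [Ll Mm blm]]] _] := gapX i.
have := ptW blm xb; rewrite ptU => -[xl|xm].
  by exists l; split=> // y z yl zl _; split=> _; exists l.
exists m; split=> // y z ym zm _; split=> [Hy|Hz]; exfalso.
  by move: Hy; apply/not_half; exists m.
by move: Hz; apply/not_half; exists m.
Qed.

Lemma tameI C D : tame C -> tame D -> tame (C `&` D)%classic.
Proof.
move=> tC tD x; have [b [xb Hb]] := tC x; have [c [xc Hc]] := tD x.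
exists (b `&` c); rewrite ptI; split=> // y z; rewrite /clp /= !ptI.
move=> [yb yc] [zb zc] H; have := Hb y z yb zb H; have := Hc y z yc zc H.
by rewrite /setI /=; tauto.
Qed.

Lemma tameC C : tame C -> tame (~` C)%classic.
Proof.
move=> tC x; have [b [xb Hb]] := tC x; exists b; split=> // y z yb zb H.
by have := Hb y z yb zb H; rewrite /setC /=; tauto.
Qed.

(** An ultrafilter [G] on [Y] containing [S] converges to a point [x], near which each [C] in [S]
    depends at most on the halves of a gap at [x]. A small element on the side chosen by [G] lies
    inside every [C]. *)
Lemma tame_lower_bound (S : set (set Y)) : countable S -> S setT ->
  (forall C, S C -> tame C) -> (forall C, S C -> exists u, C u) ->
  (forall C D, S C -> S D -> S (C `&` D)%classic) ->
  exists b, b != \bot /\ forall C, S C -> clp b `<=` C.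
Proof.
move=> cS S1 tS S0 SI.
have FF : ProperFilter (filter_from S id).
  apply: filter_from_proper; last by move=> C /S0[y Cy]; exists y.
  apply: filter_from_filter; first by exists setT.
  by move=> C D SC SD; exists (C `&` D)%classic; [exact: SI|].
have [G [GU FG]] := ultraFilterLemma FF.
have GS C : S C -> G C by move=> SC; apply: FG; exists C.
have Gpt : is_point (fun a => G (clp a)).
  split.
  - have -> : clp \bot = set0 by apply/seteqP; split=> y // /pt0.
    exact: filter_not_empty.
  - move=> a b; have -> : clp (a `&` b) = (clp a `&` clp b)%classic.
      by apply/seteqP; split=> y /= /ptI.
    exact: ultra_setI.
  - move=> a; have -> : clp (~` a) = (~` clp a)%classic.
      by apply/seteqP; split=> y /= /ptC.
    exact: ultra_setC.
pose x := Pt Gpt.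
have /choice[b Hb] C : exists b, S C -> x b /\
  forall u v, clp b u -> clp b v ->
    (forall i, x = X i -> (half i u <-> half i v)) -> (C u <-> C v).
  have [/tS/(_ x)[b Hb]|nS] := pselect (S C); first by exists b.
  by exists \bot.
have cb : countable [set b C | C in S] by exact: countable_image.
have Gex C : G C -> exists u, C u by move=> GC; exact: (@filter_ex _ G _ _ GC).
have [[i xi]|nX] := pselect (exists i, x = X i).
  have [s Es] := countable_range cb (ex_intro2 _ _ setT S1 erefl).
  (* The third gap property puts elements of both sides below all the neighbourhoods [b C]. *)
  have [_ _ /(_ s)[n|l [m [Ll Mm l0 m0 Hlm]]]] := gapX i.
    rewrite -xi; have : range s (s n) by exists n.
    by rewrite -Es => -[C SC <-]; case: (Hb C SC).
  have Hl C : S C -> l <= b C /\ m <= b C.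
    move=> SC; have : range s (b C) by rewrite -Es; exists C.
    by case=> n _ <-.
  have [Gh|Gh] := in_ultra_setVsetC (half i) GU.
    exists l; split=> // C SC y yl; have [xb HC] := Hb C SC.
    have [z [[Cz bz] hz]] : exists v, ((C `&` clp (b C)) `&` half i)%classic v.
      by apply: Gex; apply: filterI => //; apply: filterI => //; exact: GS.
    rewrite (HC y z) // => [|k]; first exact: ptW (Hl C SC).1 yl.
    by rewrite xi => /Xinj <-; split=> // _; exists l.
  exists m; split=> // C SC y ym; have [xb HC] := Hb C SC.
  have [z [[Cz bz] hz]] : exists v, ((C `&` clp (b C)) `&` ~` half i)%classic v.
    by apply: Gex; apply: filterI => //; apply: filterI => //; exact: GS.
  rewrite (HC y z) // => [|k]; first exact: ptW (Hl C SC).2 ym.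
  rewrite xi => /Xinj <-; split=> // hy; exfalso.
  by move: hy; apply/not_half; exists m.
(* When [x] is no [X i], each [C] is constant on [b C], and saturation suffices. *)
have [|p [p0 pb]] := lower_bound cb.
- by move=> s Hs; exists x => a /Hs[C SC <-]; case: (Hb C SC).
exists p; split=> // C SC y yp; have [xb HC] := Hb C SC.
have [z [Cz bz]] : exists v, (C `&` clp (b C))%classic v.
  by apply: Gex; apply: filterI => //; exact: GS.
rewrite (HC y z) // => [|k xk]; last by case: nX; exists k.
by apply: ptW yp; apply: pb; exists C.
Qed.

(** * Generic embeddings *)

Implicit Types (G : set (set Y * Pfin)) (Z : set (Y * Pfin)).

(* [G] is the graph of an isomorphism between a subalgebra of the algebra of
   tame sets and a subalgebra of [Pfin]. *)
Definition iso_graph G : Prop :=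
  [/\ G (setT, \top),
    forall C D a b, G (C, a) -> G (D, b) -> G ((C `&` D)%classic, a `&` b),
    forall C a, G (C, a) -> G ((~` C)%classic, ~` a),
    forall C a, G (C, a) -> tame C
    & forall C a, G (C, a) -> ((exists u, C u) <-> (exists x, x a))].

(** [u] is a boundary point of [d] as far as [G] can tell. *)
Definition undecided G (u : Y) d : Prop := forall C a, G (C, a) -> C u ->
  (exists x, x a /\ x d) /\ (exists x, x a /\ ~ x d).

(** A countable partial isomorphism [w.1] with countably many promises [w.2]: the pair [(u, d)]
    promises that [u] stays a boundary point of [d]. *)
Definition condition (w : set (set Y * Pfin) * set (Y * Pfin)) : Prop :=
  [/\ countable w.1, countable w.2, iso_graph w.1
    & forall u d, w.2 (u, d) -> undecided w.1 u d].

Definition mix_set (A C D : set Y) : set Y := ((A `&` C) `|` (~` A `&` D))%classic.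

Definition mix (d a b : Pfin) : Pfin := (d `&` a) `|` (~` d `&` b).

Lemma mixP d a b x : x (mix d a b) <-> (x d /\ x a) \/ (~ x d /\ x b).
Proof. by rewrite /mix ptU !ptI ptC. Qed.

Lemma mix_setP A C D u : mix_set A C D u <-> (A u /\ C u) \/ (~ A u /\ D u).
Proof. by []. Qed.

(** The algebra generated by [A] and the domain of [G] consists of the sets [mix_set A C D], so this
    is the candidate graph for extending [G] by sending [A] to [d]. *)
Definition adjoin G A d : set (set Y * Pfin) :=
  [set t | exists C D a b, [/\ G (C, a), G (D, b) & t = (mix_set A C D, mix d a b)]].

(* Sikorski's criterion for extending the isomorphism [G] by [A |-> d]. *)
Lemma adjoin_condition G Z A d : condition (G, Z) -> tame A ->
  (forall C a, G (C, a) -> ((exists u, C u /\ A u) <-> (exists x, x a /\ x d))) ->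
  (forall C a, G (C, a) -> ((exists u, C u /\ ~ A u) <-> (exists x, x a /\ ~ x d))) ->
  (forall C a u e, G (C, a) -> Z (u, e) -> C u -> A u ->
    (exists x, [/\ x a, x d & x e]) /\ (exists x, [/\ x a, x d & ~ x e])) ->
  (forall C a u e, G (C, a) -> Z (u, e) -> C u -> ~ A u ->
    (exists x, [/\ x a, ~ x d & x e]) /\ (exists x, [/\ x a, ~ x d & ~ x e])) ->
  [/\ condition (adjoin G A d, Z), G `<=` adjoin G A d & adjoin G A d (A, d)].
Proof.
move=> [/= cG cZ [G1 GI GC Gt Gi] GZ] tA HA HnA ZA ZnA.
have G0 : G (set0, \bot) by have := GC _ _ G1; rewrite setCT compl1.
have mixCE C : C = mix_set A C C.
  by apply/seteqP; split=> u; rewrite mix_setP; case: (pselect (A u)); tauto.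
have mixaE a : a = mix d a a.
  by apply: eqPt => x; rewrite mixP; case: (pselect (x d)); tauto.
split; last 2 first.
- by move=> [C a] Ga; exists C, C, a, a; split=> //; rewrite -mixCE -mixaE.
- exists setT, set0, \top, \bot; split=> //; congr (_, _).
    by apply/seteqP; split=> u; rewrite mix_setP /=; tauto.
  by apply: eqPt => x; rewrite mixP; have := pt1 x; have := @pt0 x; tauto.
split=> //=.
- apply: (@sub_countable _ _ _ ((fun t => (mix_set A t.1.1 t.2.1, mix d t.1.2 t.2.2)) @` (G `*` G))).
    by apply: subset_card_le => _ [C [D [a [b [Ga Gb ->]]]]]; exists ((C, a), (D, b)).
  by apply: countable_image; exact: countableX.
- split.
  + by exists setT, setT, \top, \top; rewrite -mixCE -mixaE.
  + move=> _ _ _ _ [C [D [a [b [Ga Gb [-> ->]]]]]] [C' [D' [a' [b' [Ga' Gb' [-> ->]]]]]].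
    exists (C `&` C')%classic, (D `&` D')%classic, (a `&` a'), (b `&` b').
    split; [exact: GI|exact: GI|congr (_, _)].
      by apply/seteqP; split=> u; rewrite /setI /= !mix_setP /=; tauto.
    by apply: eqPt => x; rewrite ptI !mixP !ptI; tauto.
  + move=> _ _ [C [D [a [b [Ga Gb [-> ->]]]]]].
    exists (~` C)%classic, (~` D)%classic, (~` a), (~` b).
    split; [exact: GC|exact: GC|congr (_, _)].
      apply/seteqP; split=> u; rewrite /setC /= !mix_setP /=;
      by case: (pselect (A u)); tauto.
    apply: eqPt => x; rewrite ptC !mixP !ptC; case: (pselect (x d)); tauto.
  + move=> _ _ [C [D [a [b [Ga Gb [-> _]]]]]].
    rewrite /mix_set -[X in tame X]setCK setCU.
    apply: tameC; apply: tameI; apply: tameC; apply: tameI => //.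
    * exact: Gt Ga.
    * exact: tameC.
    * exact: Gt Gb.
  + move=> _ _ [C [D [a [b [Ga Gb [-> ->]]]]]].
    split=> [[u /mix_setP[[Au Cu]|[Au Du]]]|[x /mixP[[xd xa]|[xd xb]]]].
    * have [x [xa xd]] := (HA _ _ Ga).1 (ex_intro _ u (conj Cu Au)).
      by exists x; rewrite mixP; left.
    * have [x [xa xd]] := (HnA _ _ Gb).1 (ex_intro _ u (conj Du Au)).
      by exists x; rewrite mixP; right.
    * have [u [Cu Au]] := (HA _ _ Ga).2 (ex_intro _ x (conj xa xd)).
      by exists u; rewrite mix_setP; left.
    * have [u [Cu Au]] := (HnA _ _ Gb).2 (ex_intro _ x (conj xb xd)).
      by exists u; rewrite mix_setP; right.
- move=> u e Zu _ _ [C [D [a [b [Ga Gb [-> ->]]]]]] /mix_setP[[Au Cu]|[Au Du]].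
    have [[x [? ? ?]] [z [? ? ?]]] := ZA _ _ _ _ Ga Zu Cu Au.
    by split; [exists x|exists z]; rewrite mixP; split=> //; left.
  have [[x [? ? ?]] [z [? ? ?]]] := ZnA _ _ _ _ Gb Zu Du Au.
  by split; [exists x|exists z]; rewrite mixP; split=> //; right.
Qed.

Lemma countable_sub_image (T U : Type) (S : set T) (B : set U) (f : T -> U) :
  countable S -> B `<=` (f @` S) -> countable B.
Proof.
move=> cS BS; apply: (@sub_countable _ _ _ (f @` S)); last exact: countable_image.
exact: subset_card_le.
Qed.

(* The elements that the image of [A] must meet. *)
Definition witnesses G Z A : set Pfin :=
  [set p | exists C a, [/\ G (C, a), exists u, C u /\ A u & p = a]] `|`
  [set p | exists C a u e, [/\ G (C, a), Z (u, e), C u /\ A u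
    & p = a `&` e \/ p = a `\` e]].

Lemma witnesses_countable G Z A : countable G -> countable Z ->
  countable (witnesses G Z A).
Proof.
move=> cG cZ; apply: countableU.
  apply: (@countable_sub_image _ _ G _ snd) => // _ [C [a [Ga _ ->]]].
  by exists (C, a).
pose f (t : bool * ((set Y * Pfin) * (Y * Pfin))) :=
  if t.1 then t.2.1.2 `&` t.2.2.2 else t.2.1.2 `\` t.2.2.2.
apply: (@countable_sub_image _ _ ([set: bool] `*` (G `*` Z)) _ f).
  by apply: countableX; [exact: countableP|exact: countableX].
move=> p [C [a [u [e [Ga Zu _ [->|->]]]]]].
  by exists (true, ((C, a), (u, e))).
by exists (false, ((C, a), (u, e))).
Qed.

(** The image [d] is a free interpolant: above the images of domain sets inside [A], disjoint from
    the images of those outside, meeting all witnesses for [A] and containing none for its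
    complement. *)
Lemma condition_extend G Z A : condition (G, Z) -> tame A ->
  exists G', [/\ condition (G', Z), G `<=` G' & exists d, G' (A, d)].
Proof.
move=> cond tA; have [/= cG cZ [G1 GI GC Gt Gi] GZ] := cond.
have G0 : G (set0, \bot) by have := GC _ _ G1; rewrite setCT compl1.
have GU C D a b : G (C, a) -> G (D, b) -> G ((C `|` D)%classic, a `|` b).
  move=> Ga Gb; rewrite -[(C `|` D)%classic]setCK setCU -[a `|` b]complK complU.
  exact: GC (GI _ _ _ _ (GC _ _ Ga) (GC _ _ Gb)).
pose low (B : set Y) : set Pfin := [set a | exists C, G (C, a) /\ C `<=` B].
have low0 B : low B \bot by exists set0; split=> // u.
have lowU B a b : low B a -> low B b -> low B (a `|` b).
  move=> [C [Ga CB]] [D [Gb DB]]; exists (C `|` D)%classic; split; first exact: GU.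
  by move=> u [/CB|/DB].
have clow B : countable (low B).
  by apply: (@countable_sub_image _ _ G _ snd) => // a [C [Ga _]]; exists (C, a).
(* The point [u] of [B] behind the witness [p] avoids [D], so [G] or the promise at [u] applies to
   [C] minus [D]. *)
have witP B p m : witnesses G Z B p -> low (~` B)%classic m -> ~ (p <= m).
  move=> Wp [D [Gm DB]]; apply/nlePt.
  have GD C a : G (C, a) -> G ((C `&` ~` D)%classic, a `&` ~` m).
    by move=> Ga; apply: GI => //; exact: GC.
  case: Wp => [[C [a [Ga [u [Cu Bu]] ->]]]|[C [a [u [e [Ga Zu [Cu Bu] He]]]]]].
    have [x] := (Gi _ _ (GD _ _ Ga)).1 (ex_intro _ u (conj Cu (fun Du => DB u Du Bu))).
    by rewrite ptI ptC => xa; exists x.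
  have [[x [xa xe]] [z [za ze]]] := GZ u e Zu _ _ (GD _ _ Ga) (conj Cu (fun Du => DB u Du Bu)).
  case: He => ->; [exists x|exists z]; move: xa za; rewrite !ptI ?ptD !ptC; tauto.
have [|||d [Ld Md Wd Wnd]] := @free_interpolant (low A) (low (~` A)%classic)
    (witnesses G Z A) (witnesses G Z (~` A)%classic)
    (clow _) (clow _) (witnesses_countable _ cG cZ) (witnesses_countable _ cG cZ)
    (low0 _) (lowU A) (low0 _) (lowU (~` A)%classic).
- move=> a b [C [Ga CA]] [D [Gb DA]]; apply/meet0P => x xa xb.
  have [u [Cu Du]] := (Gi _ _ (GI _ _ _ _ Ga Gb)).2
    (ex_intro _ x ((ptI x a b).2 (conj xa xb))).
  exact: DA Du (CA u Cu).
- by move=> p m; exact: witP.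
- by move=> p l; rewrite -{2}[A]setCK; exact: witP.
have Wd' p : witnesses G Z A p -> exists x, x p /\ x d.
  by move=> /Wd/neq0P[x /ptI]; exists x.
have Wnd' p : witnesses G Z (~` A)%classic p -> exists x, x p /\ ~ x d.
  by move=> /Wnd/nlePt.
exists (adjoin G A d); have [] // := @adjoin_condition G Z A d cond tA.
- move=> C a Ga; split=> [[u [Cu Au]]|[x [xa xd]]].
    by apply: Wd'; left; exists C, a; split=> //; exists u.
  apply: contrapT => nu; have lowa : low (~` A)%classic a.
    by exists C; split=> // u Cu Au; apply: nu; exists u.
  by move/meet0P : (Md a lowa) => /(_ x xa).
- move=> C a Ga; split=> [[u [Cu Au]]|[x [xa xd]]].
    by apply: Wnd'; left; exists C, a; split=> //; exists u.
  apply: contrapT => nu; apply: xd; apply: ptW xa; apply: Ld.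
  exists C; split=> // u Cu; apply: contrapT => Au; apply: nu; by exists u.
- move=> C a u e Ga Zu Cu Au.
  have [|x [/ptI[xa xe] xd]] := Wd' (a `&` e).
    by right; exists C, a, u, e; split=> //; left.
  have [|z [/ptD[za ze] zd]] := Wd' (a `\` e).
    by right; exists C, a, u, e; split=> //; right.
  by split; [exists x|exists z].
- move=> C a u e Ga Zu Cu Au.
  have [|x [/ptI[xa xe] xd]] := Wnd' (a `&` e).
    by right; exists C, a, u, e; split=> //; left.
  have [|z [/ptD[za ze] zd]] := Wnd' (a `\` e).
    by right; exists C, a, u, e; split=> //; right.
  by split; [exists x|exists z].
- by move=> ? ? ?; split=> //; exists d.
Qed.

(** A P-point [x] of [a] that differs from all points of [W] has, for each of them, a member that
    this point omits; a pseudo-intersection in [x] gives [b]. *)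
Lemma avoid_countable_points (W : set pt) a : countable W -> a != \bot ->
  exists b, [/\ b != \bot, b <= a & forall x, W x -> ~ x b].
Proof.
move=> cW a0; have [[w Ww]|W0] := pselect (exists w, W w); last first.
  by exists a; split=> // x Wx; case: W0; exists x.
have [f Ef] := countable_range cW Ww.
have [|x [Px xa Hx]] := @ppoint_ex nat (fun n => [set A | f n (\pi_Pfin A)]) a ch ci_nat a0.
  by move=> n A [] /= ?; rewrite pi_Pfin_setC => /ptC.
have /choice[A HA] := Hx.
have [s|b [xb bs]] := Px (fun n => if n is m.+1 then \pi_Pfin (A m) else a).
  by case: s => [|m] //; exact: (HA m).1.
exists b; split; [by apply/eqP/neq0P; exists x|exact: bs 0%N|].
rewrite Ef => _ [n _ <-] fb; apply: (HA n).2; exact: ptW (bs n.+1) fb.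
Qed.

(** Fix a point [x] of [a] and send [clp b] to [c], where [clp b] lies inside all domain sets whose
    image is in [x], and [c] below all those images. Then [clp b] and [c] have the same position
    relative to [G]. *)
Lemma condition_dense G Z a : condition (G, Z) -> a != \bot ->
  exists G', [/\ condition (G', Z), G `<=` G'
    & exists b c, [/\ b != \bot, c <= a & G' (clp b, c)]].
Proof.
move=> cond a0; have [/= cG cZ [G1 GI GC Gt Gi] GZ] := cond.
have [x xa] := pt_ex a0.
have cran : countable [set c | exists C, G (C, c)].
  by apply: (@countable_sub_image _ _ G _ snd) => // c [C Gc]; exists (C, c).
have [||a1 [a10 Ha1]] := @lower_bound (a |` [set c | x c /\ exists C, G (C, c)])%classic.
- apply: countableU1; apply: sub_countable cran; apply: subset_card_le => c []//.
- by move=> s Hs; exists x => c /Hs[->|[]].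
have a1c C c : G (C, c) -> x c -> a1 <= c.
  by move=> Gc xc; apply: Ha1; right; split=> //; exists C.
have a1nc C c y : G (C, c) -> ~ x c -> y a1 -> ~ y c.
  by move=> Gc xc ya; apply/ptC; apply: ptW ya; apply: (a1c (~` C)%classic); [exact: GC|exact/ptC].
have [|||||b0 [b00 Hb0]] := @tame_lower_bound [set C | exists c, G (C, c) /\ x c].
- by apply: (@countable_sub_image _ _ G _ fst) => // C [c [Gc _]]; exists (C, c).
- by exists \top; split=> //; exact: pt1.
- by move=> C [c [Gc _]]; exact: Gt Gc.
- by move=> C [c [Gc xc]]; apply: (Gi _ _ Gc).2; exists x.
- move=> C D [c [Gc xc]] [d [Gd xd]]; exists (c `&` d); rewrite ptI; split=> //.
  exact: GI.
(* [b] is taken inside [b1], with no promised point in [clp b]; [b2] provides a point of [clp b0]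
   outside [clp b]. *)
have [b1 [b2 [b10 b20 b1b b2b b12]]] := split_nonzero b00.
have [|b [bn0 bb1 bZ]] := @avoid_countable_points [set sval t.1 | t in Z] b1 _ b10.
  exact: countable_image.
have bb0 : b <= b0 by exact: le_trans bb1 b1b.
have [u2 u2b2] := clp_neq0 b20.
have u2b0 : clp b0 u2 by exact: ptW b2b u2b2.
have u2b : ~ clp b u2 by move=> /(ptW bb1); move/meet0P : b12 => H /H.
have [v vb] := clp_neq0 bn0.
(* [c] contains no nonzero element of [Pr], so images and promises remain visible outside [c]. *)
pose Pr : set Pfin := [set c | exists C, G (C, c)] `|`
  [set p | exists C c u e, [/\ G (C, c), Z (u, e) & p = c `&` e \/ p = c `\` e]].
have [||c [c0 ca1 cPr]] := @avoid_above a1 [set p | Pr p /\ p != \bot] a10.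
- apply: (@sub_countable _ _ _ Pr); first by apply: subset_card_le => p [].
  apply: countableU => //.
  pose f (t : bool * ((set Y * Pfin) * (Y * Pfin))) :=
    if t.1 then t.2.1.2 `&` t.2.2.2 else t.2.1.2 `\` t.2.2.2.
  apply: (@countable_sub_image _ _ ([set: bool] `*` (G `*` Z)) _ f).
    by apply: countableX; [exact: countableP|exact: countableX].
  move=> p [C [d [u [e [Ga Zu [->|->]]]]]].
    by exists (true, ((C, d), (u, e))).
  by exists (false, ((C, d), (u, e))).
- by move=> p [].
have notle p : Pr p -> (exists y, y p) -> exists y, y p /\ ~ y c.
  by move=> Pp /neq0P/eqP p0; apply/nlePt; exact: cPr.
have [y1 y1c] := pt_ex c0.
exists (adjoin G (clp b) c); have [] // := @adjoin_condition G Z (clp b) c cond (tame_clp b).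
- move=> C d Gd; have [xd|nxd] := pselect (x d).
    split=> _; first by exists y1; split=> //; exact: ptW (a1c _ _ Gd xd) (ptW ca1 y1c).
    by exists v; split=> //; apply: (Hb0 C); [exists d|exact: ptW bb0 vb].
  split=> [[u [Cu ub]]|[y [yd yc]]]; last by have := a1nc _ _ y Gd nxd (ptW ca1 yc).
  have Hn : clp b0 `<=` (~` C)%classic.
    by apply: Hb0; exists (~` d); split; [exact: GC|exact/ptC].
  by case: (Hn u (ptW bb0 ub)).
- move=> C d Gd; split=> [[u [Cu ub]]|[y [yd yc]]].
    by apply: notle; [left; exists C|apply: (Gi _ _ Gd).1; exists u].
  have [xd|nxd] := pselect (x d).
    by exists u2; split=> //; apply: (Hb0 C) => //; exists d.
  have [u Cu] := (Gi _ _ Gd).2 (ex_intro _ y yd).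
  have Hn : clp b0 `<=` (~` C)%classic.
    by apply: Hb0; exists (~` d); split; [exact: GC|exact/ptC].
  by exists u; split=> // ub; case: (Hn u (ptW bb0 ub)).
- by move=> C d u e Gd Zu Cu ub; case: (bZ (sval u)) => //; exists (u, e).
- move=> C d u e Gd Zu Cu ub; have [[x1 [x1d x1e]] [x2 [x2d x2e]]] := GZ u e Zu C d Gd Cu.
  have [||x3 [/ptI[x3d x3e] x3c]] := notle (d `&` e).
  + by right; exists C, d, u, e; split=> //; left.
  + by exists x1; apply/ptI.
  have [||x4 [/ptD[x4d x4e] x4c]] := notle (d `\` e).
  + by right; exists C, d, u, e; split=> //; right.
  + by exists x2; apply/ptD.
  by split; [exists x3|exists x4].
- move=> ? ? ?; split=> //; exists b, c; split=> //; apply: le_trans ca1 _.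
  by apply: Ha1; left.
Qed.

(** If [d] is not in the range, the domain sets with image below [d] and those with image disjoint
    from [d] leave some nonempty [clp b] uncovered. All its points are undecided, and disjoint parts
    of [b] give two of them. *)
Lemma condition_decide G Z d : condition (G, Z) -> (forall C, ~ G (C, d)) ->
  exists u v, sval u <> sval v /\ condition (G, [set (u, d); (v, d)] `|` Z).
Proof.
move=> cond nd; have [/= cG cZ [G1 GI GC Gt Gi] GZ] := cond.
(* The complement of [C] has image below [d], that of [D] has image disjoint from [d]; if [E] were
   empty, [d] would be the image of the complement of [C]. *)
pose S : set (set Y) := [set E | exists C a D b, [/\ G (C, a), G (D, b),
  forall x, ~ x a -> x d, forall x, ~ x b -> ~ x d & E = (C `&` D)%classic]].
have [|||||b [b0 Hb]] := @tame_lower_bound S.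
- apply: (@countable_sub_image _ _ (G `*` G) _ (fun t => (t.1.1 `&` t.2.1)%classic)).
    exact: countableX.
  by move=> _ [C [a [D [b [Ga Gb _ _ ->]]]]]; exists ((C, a), (D, b)).
- exists setT, \top, setT, \top; split=> //; last by rewrite setIT.
    by move=> x; case; exact: pt1.
  by move=> x; case; exact: pt1.
- by move=> _ [C [a [D [b [Ga Gb _ _ ->]]]]]; apply: tameI; [exact: Gt Ga|exact: Gt Gb].
- move=> _ [C [a [D [b [Ga Gb Ha Hb ->]]]]]; apply: contrapT => nE.
  apply: (nd (~` C)%classic); suff -> : d = ~` a by exact: GC.
  apply: eqPt => x; rewrite ptC; split=> [xd xa|/Ha//].
  apply: nE; apply: (Gi _ _ (GI _ _ _ _ Ga Gb)).2; exists x; apply/ptI; split=> //.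
  by apply: contrapT => /Hb; apply.
- move=> _ _ [C [a [D [b [Ga Gb Ha Hb ->]]]]] [C' [a' [D' [b' [Ga' Gb' Ha' Hb' ->]]]]].
  exists (C `&` C')%classic, (a `&` a'), (D `&` D')%classic, (b `&` b').
  split; [exact: GI|exact: GI| | |by rewrite setIACA].
    by move=> x; rewrite ptI => /not_andP[/Ha|/Ha'].
  by move=> x; rewrite ptI => /not_andP[/Hb|/Hb'].
have und u : clp b u -> undecided G u d.
  move=> ub C a Ga Cu; split; apply: contrapT => N.
    have SE : S (setT `&` ~` C)%classic.
      exists setT, \top, (~` C)%classic, (~` a); split=> //; first exact: GC.
        by move=> x; case; exact: pt1.
      by move=> x; rewrite ptC => /contrapT xa xd; apply: N; exists x.
    by case: (Hb _ SE u ub).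
  have SE : S (~` C `&` setT)%classic.
    exists (~` C)%classic, (~` a), setT, \top; split=> //; first exact: GC.
      move=> x; rewrite ptC => /contrapT xa; apply: contrapT => xd.
      by apply: N; exists x.
    by move=> x; case; exact: pt1.
  by case: (Hb _ SE u ub).
have [b1 [b2 [b10 b20 b1b b2b /meet0P b12]]] := split_nonzero b0.
have [u ub] := clp_neq0 b10; have [v vb] := clp_neq0 b20.
exists u, v; split; first by move=> E; apply: (b12 _ ub); rewrite E.
split=> //=; first by apply: countableU => //; apply: countableU; exact: countable1.
move=> w e [[[-> ->]|[-> ->]]|]; last exact: GZ.
  by apply: und; exact: ptW b1b ub.
by apply: und; exact: ptW b2b vb.
Qed.

Lemma chain_union (S : set {w | condition w}) : S !=set0 ->
  (forall k w, S k -> S w ->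
    ((sval k).1 `<=` (sval w).1 /\ (sval k).2 `<=` (sval w).2) \/
    ((sval w).1 `<=` (sval k).1 /\ (sval w).2 `<=` (sval k).2)) ->
  let G := (\bigcup_(w in S) (sval w).1)%classic in
  iso_graph G /\ forall w u d, S w -> (sval w).2 (u, d) -> undecided G u d.
Proof.
move=> [w0 Sw0] chain G.
have up j w : S j -> S w -> exists k, [/\ S k, (sval j).1 `<=` (sval k).1,
    (sval w).1 `<=` (sval k).1 & (sval j).2 `<=` (sval k).2].
  move=> Sv Sw; have [[? ?]|[? ?]] := chain j w Sv Sw; first by exists w; split.
  by exists j; split.
split.
- split.
  + by exists w0 => //; case: (svalP w0) => _ _ [].
  + move=> C D a b [v Sv Ca] [w Sw Db]; have [k [Sk vk wk _]] := up v w Sv Sw.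
    exists k => //; case: (svalP k) => _ _ [_ GI _ _ _] _.
    by apply: GI; [exact: vk|exact: wk].
  + move=> C a [v Sv Ca]; exists v => //.
    by case: (svalP v) => _ _ [_ _ GC _ _] _; exact: GC.
  + by move=> C a [v Sv Ca]; case: (svalP v) => _ _ [_ _ _ Gt _] _; exact: Gt Ca.
  + by move=> C a [v Sv Ca]; case: (svalP v) => _ _ [_ _ _ _ Gi] _; exact: Gi Ca.
- move=> v u d Sv Zu C a [w Sw Ca] Cu; have [k [Sk vk wk zk]] := up v w Sv Sw.
  by case: (svalP k) => _ _ _ GZ; exact: GZ (zk _ Zu) _ _ (wk _ Ca) Cu.
Qed.

(** Forcing with conditions, with one kind of task for each conclusion after the first. A promise
    once made binds all later conditions, so it holds for the union. *)
Lemma generic_graph : exists G, [/\ iso_graph G,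
  forall a, exists b, G (clp a, b),
  forall i, exists d, G (half i, d),
  forall a, a != \bot -> exists b c, [/\ b != \bot, c <= a & G (clp b, c)]
  & forall d, (exists C, G (C, d)) \/ exists u v,
      [/\ sval u <> sval v, undecided G u d & undecided G v d]].
Proof.
pose P := {w | condition w}.
pose le (v w : P) := (sval v).1 `<=` (sval w).1 /\ (sval v).2 `<=` (sval w).2.
pose D (t : (Pfin + set nat) + (Pfin + Pfin)) : set P := match t with
  | inl (inl a) => [set w | exists b, (sval w).1 (clp a, b)]
  | inl (inr i) => [set w | exists d, (sval w).1 (half i, d)]
  | inr (inl a) => [set w | a != \bot -> exists b c,
      [/\ b != \bot, c <= a & (sval w).1 (clp b, c)]]
  | inr (inr d) => [set w | (exists C, (sval w).1 (C, d)) \/ exists u v,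
      [/\ sval u <> sval v, (sval w).2 (u, d) & (sval w).2 (v, d)]]
  end.
have top0 : (\top : Pfin) != \bot by apply/eqP/pi0P; exact: infinite_nat.
have [u0 _] := clp_neq0 top0; have [x0 x0T] := pt_ex top0.
have cond0 : condition ([set (setT, \top); (set0, \bot)], set0).
  split=> //=; [by apply: countableU; exact: countable1|split].
  - by left.
  - by move=> C E a b [[-> ->]|[-> ->]] [[-> ->]|[-> ->]];
      rewrite ?setIT ?meetx1 ?set0I ?meet0x ?setI0 ?meetx0; [left|right|right|right].
  - by move=> C a [[-> ->]|[-> ->]];
      rewrite ?setCT ?compl1 ?setC0 ?compl0; [right|left].
  - move=> C a [[-> _]|[-> _]]; first by move=> x; exists \top; split=> //; exact: pt1.
    by move=> x; exists \top; split=> //; exact: pt1.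
  - move=> C a [[-> ->]|[-> ->]]; split=> -[t] //.
    + by exists x0.
    + by exists u0.
    + by move/pt0.
have [|||||K [_ Kchain KD]] := @sigma_closed_generic P _ le D (exist _ _ cond0) ch.
- by apply: ci_sum; apply: ci_sum; try exact: ci_Pfin; exact: ci_set.
- by move=> w; split.
- by move=> u v w [uv1 uv2] [vw1 vw2]; split; apply: subset_trans; eassumption.
- move=> S cS S0 chain.
  have cond_sup : condition (\bigcup_(w in S) (sval w).1, \bigcup_(w in S) (sval w).2)%classic.
    have [GS ZS] := chain_union S0 chain; split=> //=.
    + by apply: bigcup_countable => // w _; case: (svalP w).
    + by apply: bigcup_countable => // w _; case: (svalP w).
    + by move=> u d [w Sw Zu]; exact: ZS Sw Zu.
  by exists (exist _ _ cond_sup) => w Sw; split=> t wt; exists w.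
- move=> t [[G Z] cond]; case: t => [[a|i]|[a|d]].
  + have [G' [c' GG' [b Gb]]] := condition_extend cond (tame_clp a).
    by exists (exist _ _ c'); split; [split|exists b].
  + have [G' [c' GG' [b Gb]]] := condition_extend cond (tame_half i).
    by exists (exist _ _ c'); split; [split|exists b].
  + have [E|a0] := eqVneq a \bot.
      by exists (exist _ _ cond); split=> [|/eqP]; [split|rewrite E].
    have [G' [c' GG' [b [c [b0 ca Gb]]]]] := condition_dense cond a0.
    by exists (exist _ _ c'); split=> [|_]; [split|exists b, c].
  + have [[C Cd]|N] := pselect (exists C, G (C, d)).
      by exists (exist _ _ cond); split; [split|left; exists C].
    have [|u [v [uv c']]] := condition_decide cond (d := d).
      by move=> C GC; apply: N; exists C.
    exists (exist _ _ c'); split; first by split=> // t Zt; right.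
    by right; exists u, v; split=> //; left; [left|right].
have K0 : K !=set0 by have [w [Kw _]] := KD (inr (inr \bot)); exists w.
have [GK ZK] := chain_union K0 Kchain.
exists (\bigcup_(w in K) (sval w).1)%classic; split=> //.
- by move=> a; have [w [Kw [b Gb]]] := KD (inl (inl a)); exists b, w.
- by move=> i; have [w [Kw [b Gb]]] := KD (inl (inr i)); exists b, w.
- move=> a a0; have [w [Kw /(_ a0)[b [c [b0 ca Gb]]]]] := KD (inr (inl a)).
  by exists b, c; split=> //; exists w.
- move=> d; have [w [Kw [[C Gd]|[u [v [uv Zu Zv]]]]]] := KD (inr (inr d)).
    by left; exists C, w.
  by right; exists u, v; split=> //; [exact: ZK Kw Zu|exact: ZK Kw Zv].
Qed.

(** * Boundary points *)

Lemma iso_graph_le G C D a b : iso_graph G -> G (C, a) -> G (D, b) ->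
  (C `<=` D <-> a <= b).
Proof.
move=> [_ GI GC _ Gi] Ga Gb; have Gab := GI _ _ _ _ Ga (GC _ _ Gb).
split=> [CD|ab u Cu].
  apply: contrapT => /nlePt[x [xa xb]].
  have [|u [Cu Du]] := (Gi _ _ Gab).2; last exact: Du (CD _ Cu).
  by exists x; apply/ptI; rewrite ptC.
apply: contrapT => Du; have [|x] := (Gi _ _ Gab).1; first by exists u.
by move=> /ptI[xa /ptC]; apply; exact: ptW xa.
Qed.

(* [x] is in the image of both [d] and its complement under the dual of [e]. *)
Definition boundary (e : Pfin -> Pfin) d x : Prop := forall b, x b ->
  (exists y : pt, y (e b) /\ y d) /\ (exists y : pt, y (e b) /\ ~ y d).

(** Off [X i], a member of [L i] or [M i] is a neighbourhood whose image is below [d] or disjoint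
    from it. At [X i], both sides of the gap have nonzero elements below every neighbourhood. *)
Lemma boundary_half G (e : Pfin -> Pfin) i d x : iso_graph G ->
  (forall a, G (clp a, e a)) -> G (half i, d) ->
  (boundary e d x <-> x = X i).
Proof.
move=> Giso Ge Gd; have [_ GI GC _ Gi] := Giso; have [o Hlm Hs] := gapX i.
split=> [bd|-> b Xb].
  apply: contrapT => xX; have [b [xb nXb]] : exists b, x b /\ ~ X i b.
    apply: contrapT => N; apply: xX; apply: pt_ext => a xa.
    by apply: contrapT => nXa; apply: N; exists a.
  have [l [m [Ll Mm blm]]] := Hlm b nXb.
  have := ptW blm xb; rewrite ptU => -[/bd[_ [y [yl yd]]]|/bd[[y [ym yd]] _]].
    apply: yd; apply: ptW yl; apply/(iso_graph_le Giso (Ge l) Gd).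
    by move=> u ul; exists l.
  suff : e m <= ~` d by move/ptW => /(_ y ym)/ptC.
  apply/(iso_graph_le Giso (Ge m) (GC _ _ Gd)) => u um.
  by apply/not_half; exists m.
have [|l [m [Ll Mm l0 m0 Hb]]] := Hs (fun=> b); first by [].
have [lb mb] := Hb 0%N.
have [u ul] := clp_neq0 l0; have [v vm] := clp_neq0 m0; split.
  have [|y] := (Gi _ _ (GI _ _ _ _ (Ge b) Gd)).1; last by rewrite ptI; exists y.
  by exists u; split; [exact: ptW lb ul|exists l].
have [|y] := (Gi _ _ (GI _ _ _ _ (Ge b) (GC _ _ Gd))).1.
  by exists v; split; [exact: ptW mb vm|apply/not_half; exists m].
by rewrite ptI ptC; exists y.
Qed.

(** A [d] outside the range has two undecided points, both in its boundary. If [d] is the image of a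
    tame set, that set is locally constant off the [X i], so a boundary point must be one of
    them. *)
Lemma boundary_singleton G (e : Pfin -> Pfin) d x : iso_graph G ->
  (forall a, G (clp a, e a)) ->
  ((exists C, G (C, d)) \/ exists u v,
      [/\ sval u <> sval v, undecided G u d & undecided G v d]) ->
  (forall y : pt, boundary e d y <-> y = x) -> exists i, x = X i.
Proof.
move=> Giso Ge Hd bd; have [_ GI GC Gt Gi] := Giso.
case: Hd => [[C Gd]|[u [v [uv ud vd]]]]; last first.
  have bdu (w : Y) : undecided G w d -> sval w = x.
    by move=> wd; apply/bd => b wb; exact: wd (Ge b) wb.
  by case: uv; rewrite (bdu u ud) (bdu v vd).
apply: contrapT => nX; have [b [xb Hb]] := Gt _ _ Gd x.
have [[y [yb yd]] [z [zb zd]]] := (bd x).2 erefl b xb.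
have [|u [ub Cu]] := (Gi _ _ (GI _ _ _ _ (Ge b) Gd)).2.
  by exists y; apply/ptI.
have [|v [vb Cv]] := (Gi _ _ (GI _ _ _ _ (Ge b) (GC _ _ Gd))).2.
  by exists z; apply/ptI; rewrite ptC.
by apply: Cv; apply/(Hb u v) => // i xi; case: nX; exists i.
Qed.

End Doubling.

(** * The embedding *)

Lemma hom_on_setT (h : Pfin -> Pfin) : boolean_hom_on [set: Pfin] h -> bhom h.
Proof.
move=> [h0 _ hI _ hC]; split=> // [a b|a]; [apply: hI|apply: hC];
  by rewrite in_setT.
Qed.

Lemma bhom_hom_on (D : set Pfin) (h : Pfin -> Pfin) : bhom h -> boolean_hom_on D h.
Proof.
move=> [h0 hI hC]; split=> // [|a b _ _].
  by rewrite -compl0 hC h0.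
by rewrite -[a `|` b]complK complU hC hI !hC complI !complK.
Qed.

Lemma bhom_eq0 (h : Pfin -> Pfin) a : bhom h -> injective h ->
  h a = \bot <-> a = \bot.
Proof. by move=> [h0 _ _] hinj; rewrite -{1}h0; split=> [/hinj|->]. Qed.

Lemma meet_ex a b : (exists x, x a /\ x b) <-> a `&` b <> \bot.
Proof. by rewrite neq0P; split=> -[x Hx]; exists x; apply/ptI. Qed.

Lemma diff_ex a b : (exists x, x a /\ ~ x b) <-> a `&` ~` b <> \bot.
Proof.
rewrite neq0P; split=> -[x Hx]; exists x; first by apply/ptI; rewrite ptC.
by move/ptI : Hx; rewrite ptC.
Qed.

(** As [h] sends [e b] to [e (g b)], the former meets both [d] and its complement exactly when the
    latter meets both [h d] and its complement. So the dual of [g'] maps the boundary of [d] onto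
    that of [h d]. *)
Lemma boundary_automorphism (e g g' h : Pfin -> Pfin) (hom_g : bhom g)
    (hom_g' : bhom g') d x : bhom h -> injective h ->
  (forall a, e (g a) = h (e a)) -> cancel g g' -> cancel g' g ->
  (forall y : pt, boundary e (h d) y <-> y = x) ->
  forall y : pt, boundary e d y <-> y = pullback hom_g x.
Proof.
move=> hom_h hinj eg gK g'K bd y; have [_ hI hC] := hom_h.
have split_h b : ((exists z : pt, z (e b) /\ z d) /\ (exists z : pt, z (e b) /\ ~ z d)) <->
    ((exists z : pt, z (e (g b)) /\ z (h d)) /\ (exists z : pt, z (e (g b)) /\ ~ z (h d))).
  by rewrite !meet_ex !diff_ex eg -hC -!hI !(bhom_eq0 _ hom_h hinj).
have -> : boundary e d y <-> boundary e (h d) (pullback hom_g' y).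
  split=> H b /=; last by move=> yb; apply/split_h; apply: H; rewrite /= gK.
  by move=> /H/split_h; rewrite g'K.
rewrite bd; split=> [<-|->]; apply: pt_ext => a /=; first by rewrite gK.
by rewrite g'K.
Qed.

(** A nonzero element of [B] below [h d] minus [d], or below [d] minus [h d], is fixed by [h], which
    contradicts monotonicity. *)
Lemma dense_fixed (B : set Pfin) (h : Pfin -> Pfin) : bhom h ->
  (forall a, a != \bot -> exists b, [/\ B b, b != \bot & b <= a]) ->
  (forall b, B b -> h b = b) -> h = idfun.
Proof.
move=> [h0 hI hC] Bdense hB; apply/funext => d /=; apply: eqPt => x.
have hle a b : a <= b -> h a <= h b.
  by move=> /meet_idPl E; apply/meet_idPl; rewrite -hI E.
split=> xd; apply: contrapT => nx.
  have [|b [Bb /eqP/neq0P[y yb] bd]] := Bdense (h d `&` ~` d).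
    by apply/eqP/neq0P; exists x; rewrite ptI ptC.
  have yd : y (h d) by move: (ptW bd yb) => /ptI[].
  have : b <= ~` d by apply: le_trans bd _; exact: leIr.
  by move=> /hle; rewrite hB// hC => /ptW/(_ yb)/ptC; apply.
have [|b [Bb /eqP/neq0P[y yb] bd]] := Bdense (d `&` ~` h d).
  by apply/eqP/neq0P; exists x; rewrite ptI ptC.
have yd : ~ y (h d) by move: (ptW bd yb) => /ptI[_ /ptC].
have : b <= d by apply: le_trans bd _; exact: leIl.
by move=> /hle; rewrite hB// => /ptW/(_ yb).
Qed.

Theorem theorem4p6 : CH ->
  exists e : Pfin -> Pfin, embedding e /\ R_ e = [set idfun].
Proof.
move=> ch; have [X [Xdense Xrigid]] := rigid_family ch.
have Xinj : injective X.
  by move=> i j E; apply: (Xrigid idfun) => // [a|a]; [exists a|rewrite E].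
have /choice[LM gapX] i : exists LM, gap_at (X i) LM.1 LM.2.
  by have [L [M H]] := gap_ex (X i) ch; exists (L, M).
pose L i := (LM i).1; pose M i := (LM i).2.
have [G [Giso Gclp Ghalf Gdense Gdec]] := @generic_graph X L M ch Xinj gapX.
have [e Ge] := choice Gclp; exists e.
have Gle := @iso_graph_le X L M G.
have [_ GI GC _ _] := Giso.
have Gfun a c : G (clp a, c) -> c = e a.
  move=> Gc; apply/eqP; rewrite eq_le; apply/andP; split.
    exact/(Gle _ _ _ _ Giso Gc (Ge a)).
  exact/(Gle _ _ _ _ Giso (Ge a) Gc).
have clpI a b : (clp a `&` clp b)%classic = clp (a `&` b) :> set (Y L M).
  by apply/seteqP; split=> u /ptI.
have clpC a : (~` clp a)%classic = clp (~` a) :> set (Y L M).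
  by apply/seteqP; split=> u /ptC.
have hom_e : bhom e.
  have eI a b : e (a `&` b) = e a `&` e b.
    by apply/esym/Gfun; rewrite -clpI; apply: GI.
  have eC a : e (~` a) = ~` e a by apply/esym/Gfun; rewrite -clpC; apply: GC.
  split=> //; apply: eqPt => x; split=> [|/pt0//].
  have := eI \bot (~` \bot); rewrite meetxC eC => ->.
  by move=> /ptI[x0 /ptC].
have e_inj : injective e.
  have ele a b : e a <= e b -> a <= b.
    move=> /(iso_graph_le Giso (Ge a) (Ge b)) ab.
    apply: contrapT => /nlePt[x [xa xb]].
    have [|u] := @clp_neq0 X L M ch gapX (a `&` ~` b).
      by apply/eqP/neq0P; exists x; rewrite ptI ptC.
    by move=> /ptI[/ab ub /ptC].
  move=> a b E; apply/eqP; rewrite eq_le; apply/andP.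
  by split; apply: ele; rewrite E lexx.
have e_dense a : a != \bot -> exists b, [/\ range e b, b != \bot & b <= a].
  move=> /Gdense[b [c [b0 ca Gc]]]; have E := Gfun _ _ Gc.
  exists c; split=> //; first by exists b.
  by rewrite E; apply/eqP => /(bhom_eq0 _ hom_e e_inj); exact/eqP.
split; first by split=> //; exact: bhom_hom_on.
apply/seteqP; split=> [h [[[_ hinj hsurj] hom_h] [[hfun _ hsurjB] _]]|_ ->]; last first.
  have bij (D : set Pfin) : set_bij D D idfun.
    by split=> [a|a b _ _|a Da] //=; exists a.
  by split; split=> //; exact: bhom_hom_on.
have {}hom_h := hom_on_setT hom_h.
have {}hinj : injective h by move=> a b; apply: hinj; rewrite in_setT.
(* [g] is the automorphism of [Pfin] that corresponds under [e] to the restriction of [h]. *)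
have /choice[g eg] a : exists b, e b = h (e a).
  by have [|b _] := hfun (e a); [exists a|exists b].
have /choice[g' g'K] a : exists b, g b = a.
  have [|_ [b _ <-] hb] := hsurjB (e a); first by exists a.
  by exists b; apply: e_inj; rewrite eg.
have [_ hI hC] := hom_h; have [_ eI eC] := hom_e.
have ginj : injective g by move=> a b E; apply/e_inj/hinj; rewrite -!eg E.
have gK : cancel g g' by move=> a; apply: ginj; rewrite g'K.
have hom_of (k : Pfin -> Pfin) : (forall a b, k (a `&` b) = k a `&` k b) ->
    (forall a, k (~` a) = ~` k a) -> bhom k.
  by move=> kI kC; split=> //; rewrite -[X in k X](meetxC \bot) kI kC meetxC.
have gI a b : g (a `&` b) = g a `&` g b by apply: e_inj; rewrite eg !eI hI !eg.
have gC a : g (~` a) = ~` g a by apply: e_inj; rewrite eg !eC hC !eg.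
have hom_g := hom_of g gI gC.
have hom_g' : bhom g'.
  by apply: hom_of => [a b|a]; apply: ginj; rewrite ?gI ?gC !g'K.
have Xfix i a : X i (g a) <-> X i a.
  (* [c] is the preimage under [h] of an element with boundary [X i]. So its boundary is the single
     point [pullback hom_g (X i)], which must be some [X j], and rigidity gives [i = j]. *)
  have [d Gd] := Ghalf i; have [c _ hc] := hsurj d I.
  have bdd y : boundary e (h c) y <-> y = X i.
    by rewrite hc; exact (@boundary_half X L M ch gapX G e i d y Giso Ge Gd).
  have [j Ej] : exists j, pullback hom_g (X i) = X j.
    apply: (boundary_singleton Giso Ge (Gdec c)).
    apply: (@boundary_automorphism e g g' h hom_g hom_g' c (X i)) => //.
  have Eij b : X j b <-> X i (g b) by rewrite -Ej.
  rewrite -Eij; suff -> : i = j by [].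
  by apply: (Xrigid g i j hom_g ginj) => // b; exists (g' b).
(* The same [X i] lie in [a] and [g a]; as the [X i] are dense, [g a = a], so [h] fixes the dense
   range of [e]. *)
apply: (dense_fixed hom_h e_dense) => _ [a _ <-]; rewrite -eg; congr e.
apply: eqPt => x; split=> xa; apply: contrapT => nx.
  have [|i] := Xdense (g a `&` ~` a).
    by apply/eqP/neq0P; exists x; rewrite ptI ptC.
  by rewrite ptI ptC Xfix => -[].
have [|i] := Xdense (a `&` ~` g a).
  by apply/eqP/neq0P; exists x; rewrite ptI ptC.
by rewrite ptI ptC Xfix => -[].
Qed.
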